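(* Let $\alpha\in(0,1)$ and let $\mathcal A$ be a compact subset of the metric space $(\ell^\alpha\log\ell,d)$ such that $$\sum_{k=1}^\infty\sup_{\mathbf a\in\mathcal A}h(a_k)<\infty.$$ Then the processes $(Y(\mathbf a))_{\mathbf a\in\mathcal A}$ and $(\widetilde Y(\mathbf a))_{\mathbf a\in\mathcal A}$ have continuous sample paths, and in $\mathbb C(\mathcal A)$ (continuous functions on $(\mathcal A,d)$ with the uniform topology) $$(X_n(\mathbf a))_{\mathbf a\in\mathcal A}\Longrightarrow(Y(\mathbf a))_{\mathbf a\in\mathcal A},\qquad(\widetilde X_n(\mathbf a))_{\mathbf a\in\mathcal A}\Longrightarrow(\widetilde Y(\mathbf a))_{\mathbf a\in\mathcal A}.$$
   Context: Let $(\varepsilon_t)_{t\in\mathbb Z}$ be i.i.d. symmetric $\alpha$-stable with $E e^{\mathrm i u\varepsilon_1}=e^{-|u|^\alpha}$; $\gamma_{n,\varepsilon}(h)=\frac1n\sum_{t=1}^{n-h}\varepsilon_t\varepsilon_{t+h}$, $\rho_{n,\varepsilon}(h)=\gamma_{n,\varepsilon}(h)/\gamma_{n,\varepsilon}(0)$. Let $Y_0,Y_1,\dots$ be independent, $Y_0\sim S_{\alpha/2}(\sigma_1,1,0)$, $Y_1,Y_2,\dots$ i.i.d. $S_\alpha(\sigma_2,0,0)$, where $\sigma_1,\sigma_2>0$ (depending only on $\alpha$) are such that for every $m$, $\big(n\gamma_{n,\varepsilon}(0)/n^{2/\alpha}, n\gamma_{n,\varepsilon}(h)/(n\log n)^{1/\alpha},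 h=1,\dots,m\big)\Rightarrow(Y_0,\dots,Y_m)$. Let $h(x)=|x|^\alpha\log(b+|x|^{-1})$ for $x\ne0$, $h(0)=0$, with $b>0$ fixed so large that $h$ is concave on $(0,\infty)$. Then $\ell^\alpha\log\ell=\{\mathbf a=(a_1,a_2,\dots):\sum_kh(a_k)<\infty\}$, a linear metric space with metric $d(\mathbf a,\mathbf b)=\sum_kh(a_k-b_k)$. For $\mathbf a\in\ell^\alpha\log\ell$: $X_n(\mathbf a)=(n\log n)^{-1/\alpha}\sum_{k=1}^{n-1}a_k[n\gamma_{n,\varepsilon}(k)]$, $\widetilde X_n(\mathbf a)=(n/\log n)^{1/\alpha}\sum_{k=1}^{n-1}a_k\rho_{n,\varepsilon}(k)$, $Y(\mathbf a)=\sum_{k\ge1}a_kY_k$, $\widetilde Y(\mathbf a)=Y(\mathbf a)/Y_0$. *)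

(* Defs.v *)
From HB Require Import structures.
From mathcomp Require Import all_boot all_order all_algebra.
From mathcomp Require Import all_classical all_reals all_analysis.
Set Implicit Arguments. Unset Strict Implicit. Unset Printing Implicit Defensive.
Import Order.TTheory GRing.Theory Num.Theory.
Import numFieldNormedType.Exports.
Local Open Scope classical_set_scope.
Local Open Scope ring_scope.

Section Defs.
Variable R : realType.

(** Sequences a = (a_1, a_2, ...) are represented as [a : nat -> R] with
    a_k = a (k-1), i.e. [coord a k] for k >= 1. *)
Definition coord (a : nat -> R) (k : nat) : R := a k.-1.

Definition hfun (alpha b x : R) : R :=
  if x == 0 then 0 else `|x| `^ alpha * ln (b + `|x|^-1).

Definition ellalog (alpha b : R) (a : nat -> R) : Prop :=
  cvgn (series (fun k => hfun alpha b (a k))).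

Definition ldist (alpha b : R) (a c : nat -> R) : R :=
  limn (series (fun k => hfun alpha b (a k - c k))).

Definition ld_open (alpha b : R) (U : set (nat -> R)) : Prop :=
  forall a, ellalog alpha b a -> U a ->
    exists2 r : R, 0 < r & forall c, ellalog alpha b c -> ldist alpha b a c < r -> U c.

Definition ld_compact (alpha b : R) (A : set (nat -> R)) : Prop :=
  A `<=` ellalog alpha b /\
  forall F : set (set (nat -> R)), (forall U, F U -> ld_open alpha b U) ->
    A `<=` \bigcup_(U in F) U ->
    exists G : set (set (nat -> R)), [/\ G `<=` F, finite_set G &
      A `<=` \bigcup_(U in G) U].

Definition ld_cont (alpha b : R) (A : set (nat -> R)) (f : (nat -> R) -> R) : Prop :=
  forall a, A a -> forall e : R, 0 < e -> exists2 r : R, 0 < r &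
    forall c, A c -> ldist alpha b a c < r -> `|f a - f c| < e.

Section Prob.
Context {d : measure_display} {T : measurableType d}.

Definition has_cf (P : probability T R) (X : T -> R) (phr phi : R -> R) : Prop :=
  forall u : R,
    (\int[P]_w (cos (u * X w))%:E = (phr u)%:E)%E /\
    (\int[P]_w (sin (u * X w))%:E = (phi u)%:E)%E.

Definition mutual_indep (P : probability T R) (X : nat -> T -> R) : Prop :=
  forall (s : seq nat) (B : nat -> set R), uniq s ->
    (forall i, measurable (B i)) ->
    P (\bigcap_(i in [set` s]) (X i @^-1` B i)) = (\prod_(i <- s) P (X i @^-1` B i))%E.

End Prob.

(** characteristic function of S_a(sigma, beta, 0), a <> 1:
    exp(-sigma^a |u|^a (1 - i beta sign(u) tan(pi a / 2))) *)
Definition stable_cf_re (a sigma beta u : R) : R :=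
  expR (- (sigma `^ a * `|u| `^ a)) *
  cos (sigma `^ a * `|u| `^ a * beta * Num.sg u * tan (pi * a / 2)).
Definition stable_cf_im (a sigma beta u : R) : R :=
  expR (- (sigma `^ a * `|u| `^ a)) *
  sin (sigma `^ a * `|u| `^ a * beta * Num.sg u * tan (pi * a / 2)).

Section Processes.
Context {T : Type}.
Variable eps : nat -> T -> R.

Definition ngamma (n h : nat) (w : T) : R :=
  \sum_(1 <= t < (n - h).+1) eps t w * eps (t + h) w.

Definition Xn (alpha : R) (n : nat) (a : nat -> R) (w : T) : R :=
  (n%:R * ln n%:R) `^ (- alpha^-1) *
  \sum_(1 <= k < n) coord a k * ngamma n k w.

Definition Xtn (alpha : R) (n : nat) (a : nat -> R) (w : T) : R :=
  (n%:R / ln n%:R) `^ (alpha^-1) *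
  \sum_(1 <= k < n) coord a k * (ngamma n k w / ngamma n 0 w).

Variable Y : nat -> T -> R.
Definition Yseries (a : nat -> R) (w : T) : nat -> R :=
  series (fun k => coord a k.+1 * Y k.+1 w).
Definition Yproc (a : nat -> R) (w : T) : R := limn (Yseries a w).
Definition Ytproc (a : nat -> R) (w : T) : R := Yproc a w / Y 0 w.
End Processes.

Definition proc_weak_cvg (alpha b : R) (A : set (nat -> R))
  {d1 d2 : measure_display} {T1 : measurableType d1} {T2 : measurableType d2}
  (P : probability T1 R) (X : nat -> (nat -> R) -> T1 -> R)
  (Q : probability T2 R) (Z : (nat -> R) -> T2 -> R) : Prop :=
  forall F : ((nat -> R) -> R) -> R,
    (exists M : R, forall f, `|F f| <= M) ->
    (forall f, ld_cont alpha b A f -> forall e : R, 0 < e ->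
       exists2 r : R, 0 < r & forall g, ld_cont alpha b A g ->
         (forall a, A a -> `|f a - g a| <= r) -> `|F f - F g| < e) ->
    ((fun n => \int[P]_w (F (fun a => X n a w))%:E) @ \oo -->
       \int[Q]_w (F (fun a => Z a w))%:E)%E.

Definition vec_weak_cvg (m : nat)
  {d1 d2 : measure_display} {T1 : measurableType d1} {T2 : measurableType d2}
  (P : probability T1 R) (V : nat -> T1 -> 'rV[R]_m.+1)
  (Q : probability T2 R) (W : T2 -> 'rV[R]_m.+1) : Prop :=
  forall f : 'rV[R]_m.+1 -> R, (exists M : R, forall x, `|f x| <= M) ->
    continuous f ->
    ((fun n => \int[P]_w (f (V n w))%:E) @ \oo --> \int[Q]_w (f (W w))%:E)%E.

End Defs.

(* Main.v *)
(* For a in A the k-th coordinate is bounded by rad k = sup |a_k|, and the summability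
   hypothesis gives sum_k rad_k^alpha (1 - ln rad_k) < oo. Since alpha < 1, everything can
   be estimated termwise with absolute values: if Z = eps_t eps_(t+k) and
   c_n = (n ln n)^(1/alpha), a dyadic decomposition of both factors gives
   n E min(1, s |Z| / c_n) <= C s^alpha (1 - ln s) for 0 < s <= 1, uniformly in large n.
   Summing over k > m bounds the supremum over A of the remainder of X_n(a) beyond m
   uniformly in n; the same estimate with the second factor replaced by 1 shows
   sum_k rad_k |Y_k| < oo almost surely, whence the continuity of the paths. The first m terms converge by the
   finite-dimensional limit theorem. The tail bound P(|eps| >= x) <= 5 x^(-alpha) comes
   from averaging 1 - cos(u eps) over u, and Y_0 has no atom at 0 because its
   characteristic function vanishes at infinity; the latter handles the division by
   gamma_n(0) in the normalised process. *)
Require Import Defs.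
From HB Require Import structures.
From mathcomp Require Import all_boot all_order all_algebra.
From mathcomp Require Import all_classical all_reals all_analysis.
From mathcomp Require Import measurable_realfun ring lra zify.
Set Implicit Arguments.
Unset Strict Implicit.
Unset Printing Implicit Defensive.
Import Order.TTheory GRing.Theory Num.Theory.
Import numFieldNormedType.Exports.
Local Open Scope classical_set_scope.
Local Open Scope ring_scope.

(** * Expectations of bounded measurable functions *)

(** The functionals [F] of [proc_weak_cvg] are arbitrary bounded maps, continuous for the uniform
    distance at continuous paths; neither measurability nor uniform continuity is assumed.
    Measurability is obtained along finite linear forms, where [F] becomes a continuous function of
    finitely many real variables, and is inherited by pointwise limits. Uniform continuity is
    obtained by approximating [F] from below by Lipschitz functionals. Since [alpha < 1], neither
    [eps_t eps_(t+k)] nor [Y_k] has a finite absolute mean, so every first-moment argument runs on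
    truncations [min(1, .)]; a sum of such truncations that stays below 1 has no active truncation,
    which turns a small mean into a pathwise bound of the remainder. Both processes are linear forms
    in random coefficients (normalised lags, divided by the normalised lag 0 for the ratio), so one
    abstract convergence result serves both. Its assumptions are required at every sample point, so
    [Y] is first set to 0 on the null set where its dominating series may diverge. *)

Section Expectation.
Context {R : realType} {d : measure_display} {T : measurableType d}.
Variable P : probability T R.
Implicit Types (U V D : T -> R).

Definition bounded_mfun U := measurable_fun setT U /\ exists M, forall w, `|U w| <= M.

Lemma bounded_mfun_integrable U : bounded_mfun U -> P.-integrable setT (EFin \o U).
Proof.
move=> [mU [M UM]]; apply: measurable_bounded_integrable => //;
  first by rewrite -ge0_fin_numE// fin_num_measure.
exists M; split; first exact: num_real.
by move=> M' MM' w _; apply: (le_trans (UM w)); exact: ltW.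
Qed.

Lemma bounded_mfun_cst c : bounded_mfun (fun=> c).
Proof. by split; [exact: measurable_cst | exists `|c|]. Qed.

Lemma bounded_mfunD U V : bounded_mfun U -> bounded_mfun V ->
  bounded_mfun (fun w => U w + V w).
Proof.
move=> [mU [M UM]] [mV [N VN]]; split; first exact: measurable_funD.
by exists (M + N) => w; rewrite (le_trans (ler_normD _ _))// lerD.
Qed.

Lemma bounded_mfunM U V : bounded_mfun U -> bounded_mfun V ->
  bounded_mfun (fun w => U w * V w).
Proof.
move=> [mU [M UM]] [mV [N VN]]; split; first exact: measurable_funM.
by exists (M * N) => w; rewrite normrM ler_pM.
Qed.

Lemma bounded_mfunZ c U : bounded_mfun U -> bounded_mfun (fun w => c * U w).
Proof. exact/bounded_mfunM/bounded_mfun_cst. Qed.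

Lemma bounded_mfun_sum (I : Type) (s : seq I) (p : pred I) (F : I -> T -> R) :
  (forall i, p i -> bounded_mfun (F i)) ->
  bounded_mfun (fun w => \sum_(i <- s | p i) F i w).
Proof.
move=> bF; elim: s => [|i s IH].
  by under [X in bounded_mfun X]funext do rewrite big_nil; exact: bounded_mfun_cst.
under [X in bounded_mfun X]funext do rewrite big_cons.
by have [pi|_] := boolP (p i); [exact/bounded_mfunD/IH/bF|].
Qed.

Lemma bounded_mfun_indic A : measurable A -> bounded_mfun (fun w => \1_A w).
Proof.
move=> mA; split; first exact: measurable_indic.
by exists 1 => w; rewrite indicE ger0_norm ?ler0n// lern1 leq_b1.
Qed.

Lemma EFin_Rintegral U : bounded_mfun U ->
  (\int[P]_w (U w)%:E)%E = (\int[P]_w U w)%:E.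
Proof.
by move=> /bounded_mfun_integrable bU; rewrite /Rintegral fineK// integrable_fin_num.
Qed.

Lemma expectD U V : bounded_mfun U -> bounded_mfun V ->
  \int[P]_w (U w + V w) = \int[P]_w U w + \int[P]_w V w.
Proof. by move=> bU bV; rewrite RintegralD//; exact: bounded_mfun_integrable. Qed.

Lemma expectZ c U : bounded_mfun U -> \int[P]_w (c * U w) = c * \int[P]_w U w.
Proof. by move=> bU; rewrite RintegralZl//; exact: bounded_mfun_integrable. Qed.

Lemma expect_cst c : \int[P]_w c = c.
Proof.
rewrite Rintegral_cst// -[RHS]mulr1; congr (c * _).
by rewrite -[RHS]/(fine 1%E); congr fine; exact: probability_setT.
Qed.

Lemma le_expect U V : bounded_mfun U -> bounded_mfun V -> (forall w, U w <= V w) ->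
  \int[P]_w U w <= \int[P]_w V w.
Proof. by move=> bU bV UV; apply: le_Rintegral => //; exact: bounded_mfun_integrable. Qed.

Lemma expect_sum (I : Type) (s : seq I) (p : pred I) (F : I -> T -> R) :
  (forall i, p i -> bounded_mfun (F i)) ->
  \int[P]_w (\sum_(i <- s | p i) F i w) = \sum_(i <- s | p i) \int[P]_w F i w.
Proof.
move=> bF; elim: s => [|i s IH].
  by rewrite big_nil; under eq_Rintegral do rewrite big_nil; rewrite expect_cst.
under eq_Rintegral do rewrite big_cons; rewrite big_cons.
case: ifPn => // pi; rewrite expectD ?IH//; first exact: bF.
exact: bounded_mfun_sum.
Qed.

Lemma expect_indic A : measurable A -> \int[P]_w \1_A w = fine (P A).
Proof. by move=> mA; rewrite /Rintegral integral_indic// setIT. Qed.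

(** Markov's inequality is built in: in the applications [D] exceeds a fixed threshold wherever [U]
    and [V] may be far apart, so [K * D] absorbs the crude bound on their difference and the
    exceptional event is never named. *)
Lemma expect_dist_le U V D e K : bounded_mfun U -> bounded_mfun V -> bounded_mfun D ->
  (forall w, `|U w - V w| <= e + K * D w) ->
  `|\int[P]_w U w - \int[P]_w V w| <= e + K * \int[P]_w D w.
Proof.
move=> bU bV bD UV.
have bB : bounded_mfun (fun w => e + K * D w).
  exact/bounded_mfunD/bounded_mfunZ/bD/bounded_mfun_cst.
have eB : \int[P]_w (e + K * D w) = e + K * \int[P]_w D w.
  rewrite expectD ?expect_cst ?expectZ//; first exact: bounded_mfun_cst.
  exact: bounded_mfunZ.
have h : forall X Y, bounded_mfun X -> bounded_mfun Y ->
    (forall w, X w <= Y w + (e + K * D w)) ->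
    \int[P]_w X w <= \int[P]_w Y w + (e + K * \int[P]_w D w).
  move=> X Y bX bY XY; rewrite -eB -expectD//; apply: le_expect => //.
  exact: bounded_mfunD.
rewrite ler_norml; apply/andP; split.
  rewrite lerNl opprB lerBlDl; apply: h => // w.
  by have := UV w; rewrite ler_norml => /andP[]; lra.
rewrite lerBlDl; apply: h => // w.
by have := UV w; rewrite ler_norml => /andP[]; lra.
Qed.

Lemma bounded_mfun_cvg (F : nat -> T -> R) U (M : R) : (forall n, measurable_fun setT (F n)) ->
  (forall n w, `|F n w| <= M) -> (forall w, F ^~ w @ \oo --> U w) -> bounded_mfun U.
Proof.
move=> mF FM FU; split; first exact: measurable_fun_cvg (fun w _ => FU w).
exists M => w; have /cvg_norm FUw := FU w.
rewrite -(cvg_lim _ FUw)//; apply: limr_le; first by apply/cvg_ex; eexists; exact: FUw.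
by apply: nearW => n.
Qed.

Lemma expect_cvg (F : nat -> T -> R) U (M : R) : (forall n, measurable_fun setT (F n)) ->
  (forall n w, `|F n w| <= M) -> (forall w, F ^~ w @ \oo --> U w) ->
  (fun n => \int[P]_w F n w) @ \oo --> \int[P]_w U w.
Proof.
move=> mF FM FU; have bU := bounded_mfun_cvg mF FM FU.
have bF n : bounded_mfun (F n) by split => //; exists M.
have mE V : measurable_fun setT V -> measurable_fun setT (fun w => (V w)%:E).
  by move=> mV; exact/measurable_EFinP.
have FUE w : (F n w)%:E @[n --> \oo] --> (U w)%:E.
  by apply: cvg_EFin (FU w); exact: nearW.
have [_ _] := @dominated_convergence _ _ _ P setT measurableT
  (fun n w => (F n w)%:E) (fun w => (U w)%:E) (fun=> M%:E)
  (fun n => mE _ (mF n)) (mE _ bU.1) (aeW _ (fun w _ => FUE w))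
  (bounded_mfun_integrable (bounded_mfun_cst M))
  (aeW _ (fun w n _ => FM n w)).
by rewrite (EFin_Rintegral bU) => /fine_cvg.
Qed.

End Expectation.

(** * Changing a possibly nonmeasurable integrand on a null set *)

Section AlmostEverywhere.
Context {R : realType} {d : measure_display} {T : measurableType d}.
Variable P : probability T R.
Import HBNNSimple.

(* Nonnegative functions are integrated as suprema over the simple functions
   below them, and multiplying such a simple function by the indicator of ~` N
   does not change its integral. *)
Lemma integral_eq_off_null (N : set T) (U V : T -> R) : measurable N -> P N = 0%E ->
  (forall w, ~ N w -> U w = V w) ->
  (\int[P]_w (U w)%:E = \int[P]_w (V w)%:E)%E.
Proof.
move=> mN PN UV.
have mNC : measurable (~` N) by exact: measurableC.
have sub (u v : T -> \bar R) : (forall x, 0 <= u x)%E -> (forall x, 0 <= v x)%E ->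
    (forall x, ~ N x -> u x = v x) -> (\int[P]_x u x <= \int[P]_x v x)%E.
  move=> u0 v0 uv; rewrite [leLHS]ge0_integralTE// [leRHS]ge0_integralTE//.
  apply: ge_ereal_sup => _ [h /= hu <-].
  apply: ereal_sup_ubound; exists (proj_nnsfun h mNC) => /=.
    move=> x; rewrite mindicE; case: (boolP (x \in ~` N)) => [|_].
      by rewrite inE => Nx; rewrite mulr1 -uv.
    by rewrite mulr0.
  have hI (g : {nnsfun T >-> R}) : sintegral P g = (\int[P]_x (g x)%:E)%E.
    by rewrite integral_nnsfun// patch_setT.
  rewrite !hI; apply: ae_eq_integral => //; try exact/measurable_EFinP.
  exists N; split => // x /= hx; apply: contrapT => Nx; apply: hx => _.
  by rewrite mindicE mem_set// mulr1.
rewrite [LHS]integralE [RHS]integralE; congr (_ - _)%E; apply/eqP; rewrite eq_le;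
  by apply/andP; split; apply: sub => // x Nx; rewrite ?funeposE ?funenegE /= UV.
Qed.

End AlmostEverywhere.

(** * Continuity and measurability on row vectors *)

Section RowVectors.
Context {R : realType}.

Lemma rV_continuousP (m : nat) (f : 'rV[R]_m.+1 -> R) : continuous f <->
  forall (x : 'rV[R]_m.+1) (e : R), 0 < e -> exists2 r : R, 0 < r &
    forall y : 'rV[R]_m.+1, (forall i, `|x 0 i - y 0 i| < r) -> `|f x - f y| < e.
Proof.
split=> [cf x e e0|h x].
  have /cvgrPdist_lt /(_ e e0) := cf x.
  move=> /nbhs_ballP[r /= r0 xr]; exists r => // y xy.
  apply: xr; split => // i j; rewrite (ord1 i) /ball /=; exact: xy.
move=> B /nbhs_ballP[e /= e0 eB]; have [r r0 xr] := h x e e0.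
apply/nbhs_ballP; exists r => //= y [_ xy]; apply: eB; apply: xr => i; exact: xy.
Qed.

(** The preimage of a half-line []a, +oo[] is the union of those boxes, with rational centres and
    radii [1/(k+1)], that lie inside it. There are countably many boxes, and each is a finite
    intersection of measurable sets. *)
Lemma measurable_continuous_rV (d : measure_display) (T : measurableType d) (m : nat)
    (f : 'rV[R]_m.+1 -> R) (V : 'I_m.+1 -> T -> R) :
  continuous f -> (forall i, measurable_fun setT (V i)) ->
  measurable_fun setT (fun w => f (\row_i V i w)).
Proof.
move=> /rV_continuousP cf mV.
apply: (measurability _ (RGenOInfty.measurableE R)) => //.
move=> /= _ [_ [a ->] <-]; rewrite setTI.
pose box (q : {ffun 'I_m.+1 -> rat} * nat) : set T :=
  \bigcap_(i in [set: 'I_m.+1]) [set w | `|V i w - ratr (q.1 i)| < q.2.+1%:R^-1].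
pose good (q : {ffun 'I_m.+1 -> rat} * nat) :=
  forall w, box q w -> a < f (\row_i V i w).
rewrite (_ : _ @^-1` _ = \bigcup_(q in good) box q); last first.
  apply/seteqP; split=> w /=; last by move=> [q gq bq]; rewrite in_itv /= andbT gq.
  rewrite in_itv /= andbT => aw.
  have [r r0 wr] := cf (\row_i V i w) (f (\row_i V i w) - a) ltac:(by rewrite subr_gt0).
  have [k kr] : exists k : nat, k.+1%:R^-1 < r / 2.
    exists (Num.truncn ((r / 2)^-1)); have r2 : 0 < r / 2 by lra.
    by rewrite -[ltRHS]invrK ltf_pV2 ?posrE ?invr_gt0// truncnS_gt.
  have [u uE] : exists u, u = k.+1%:R^-1 :> R by exists k.+1%:R^-1.
  have u0 : 0 < u by rewrite uE invr_gt0.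
  have ex i : exists q : rat, `|V i w - ratr q| < u.
    have /rat_in_itvoo[q] : V i w - u < V i w + u by lra.
    rewrite in_itv /= => /andP[q1 q2]; exists q.
    by rewrite ltr_norml; apply/andP; split; lra.
  pose q := [ffun i => sval (cid (ex i))].
  have qw i : `|V i w - ratr (q i)| < u by rewrite ffunE; case: cid.
  exists (q, k); last by move=> i _ /=; rewrite -uE.
  move=> w' bw'; have {bw'} bw' i : `|V i w' - ratr (q i)| < u by rewrite uE; exact: bw'.
  have := wr (\row_i V i w'); rewrite ltr_norml => H.
  suff /H : forall i, `|(\row_i V i w) 0 i - (\row_i V i w') 0 i| < r by lra.
  move=> i; rewrite !mxE; have := bw' i; have := qw i; rewrite -uE in kr.
  by rewrite !ltr_norml => /andP[p1 p2] /andP[p3 p4]; apply/andP; split; lra.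
rewrite bigcup_mkcond; apply: countable_bigcupT_measurable; first exact: countableP.
move=> q; case: ifP => // _; apply: fin_bigcap_measurable => [|i _].
  exact: finite_finset.
rewrite (_ : mkset _ = (fun w => `|V i w - ratr (q.1 i)|) @^-1` `]-oo, q.2.+1%:R^-1[%classic).
  rewrite -[X in measurable X]setTI.
  suff: measurable_fun setT (fun w => `|V i w - ratr (q.1 i)|) by apply.
  by apply: measurableT_comp => //; exact: measurable_funB.
by apply/seteqP; split => w /=; rewrite in_itv.
Qed.

End RowVectors.

(** * The gauge h *)

Lemma one_powR {R : realType} (p : R) : 1 `^ p = 1 :> R.
Proof. by rewrite powR1. Qed.

Section Gauge.
Context {R : realType}.
Variables alpha b : R.
Hypothesis alpha01 : 0 < alpha < 1.
Hypothesis b_gt0 : 0 < b.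
Hypothesis h_concave : forall x y t : R, 0 < x -> 0 < y -> 0 <= t <= 1 ->
  t * hfun alpha b x + (1 - t) * hfun alpha b y <=
  hfun alpha b (t * x + (1 - t) * y).
Local Notation h := (hfun alpha b).

Let alpha_gt0 : 0 < alpha. Proof. by case/andP: alpha01. Qed.

(** Once [y] is at least [max(K, 1)^(1/(1-alpha))], the factor [y^(1-alpha)] dominates [K]; the
    bound [m] lets [y] be pushed as far out as needed. *)
Lemma powR_sublinear (K m : R) : exists y : R, [/\ m <= y, 1 <= y & K * y `^ alpha <= y].
Proof.
have a1 : 0 < 1 - alpha by case/andP: alpha01; lra.
pose K1 := Num.max K 1; pose z := K1 `^ (1 - alpha)^-1; pose y := Num.max m (Num.max 1 z).
have K1_gt0 : 0 < K1 by rewrite lt_max ltr01 orbT.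
have y1 : 1 <= y by rewrite !le_max lexx orbT.
have y0 : 0 < y by lra.
exists y; split => //; first by rewrite le_max lexx.
have Ky : K1 <= y `^ (1 - alpha).
  have -> : K1 = z `^ (1 - alpha).
    by rewrite /z -powRrM mulVf ?gt_eqF// powRr1// ltW.
  rewrite ge0_ler_powR ?nnegrE ?powR_ge0//; [lra | lra |].
  by rewrite !le_max lexx !orbT.
have yE : y = y `^ (1 - alpha) * y `^ alpha.
  by rewrite -powRD ?subrK ?powRr1 ?(ltW y0)// gt_eqF// implybT.
rewrite [leRHS]yE; apply: ler_wpM2r; first exact: powR_ge0.
by apply: le_trans Ky; rewrite le_max lexx.
Qed.

Lemma hfun_pos x : 0 < x -> h x = x `^ alpha * ln (b + x^-1).
Proof. by move=> x0; rewrite /hfun gt_eqF// gtr0_norm. Qed.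

Lemma hfun_norm x : h `|x| = h x.
Proof. by rewrite /hfun normr_eq0 normr_id. Qed.

Lemma hfun0 : h 0 = 0. Proof. by rewrite /hfun eqxx. Qed.

(* h(y) >= y^alpha ln b is bounded below by a sublinear function, so the concave
   function h cannot decrease anywhere. *)
Lemma hfun_nondecreasing x z : 0 < x -> x <= z -> h x <= h z.
Proof.
move=> x0; rewrite le_eqVlt => /predU1P[->//|xz].
rewrite leNgt; apply/negP => hzx.
pose C := `|h x| + `|ln b|.
have C0 : 0 <= C by rewrite addr_ge0.
(* Concavity will give [(h x - h z) (y - x) <= (z - x) C y^alpha], and [2 z <= y] gives
   [y <= 2 (y - x)]. With this [K], the inequality [K y^alpha <= y] contradicts both; the [+ 1]
   supplies the strict surplus [(h x - h z) y^alpha]. *)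
pose K := 2 * (z - x) * C / (h x - h z) + 1.
have [y [my y1 Ky]] := powR_sublinear K (2 * z).
have ya : 1 <= y `^ alpha by rewrite -(one_powR alpha) ge0_ler_powR ?nnegrE//; [exact: ltW|lra].
have yx : 0 < y - x by lra.
pose t := (y - z) / (y - x).
have t1 : 1 - t = (z - x) / (y - x) by rewrite /t; field; exact: lt0r_neq0.
have t01 : 0 <= t <= 1.
  apply/andP; split; first by rewrite /t divr_ge0//; lra.
  have : 0 <= 1 - t by rewrite t1 divr_ge0//; lra.
  lra.
have := @h_concave x y t x0 (lt_le_trans ltr01 y1) t01.
have -> : t * x + (1 - t) * y = z by rewrite t1 /t; field; exact: lt0r_neq0.
have hy : - (`|ln b| * y `^ alpha) <= h y.
  rewrite hfun_pos; last lra.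
  rewrite mulrC -mulrN; apply: ler_wpM2l; first exact: powR_ge0.
  apply: (@le_trans _ _ (ln b)); first by rewrite lerNl ler_normr lexx orbT.
  have yV : 0 < y^-1 by rewrite invr_gt0; lra.
  by rewrite ler_ln ?posrE ?lerDl ?addr_gt0// ltW.
move=> H.
have H1 : h x - h z <= (1 - t) * (h x - h y) by lra.
have H2 : h x - h y <= C * y `^ alpha.
  have : h x <= `|h x| by exact: ler_norm.
  have : `|h x| * 1 <= `|h x| * y `^ alpha by exact: ler_wpM2l.
  by rewrite /C mulrDl; lra.
have H3 : (h x - h z) * (y - x) <= (z - x) * (C * y `^ alpha).
  have : (1 - t) * (h x - h y) <= (1 - t) * (C * y `^ alpha).
    by apply: ler_wpM2l => //; lra.
  rewrite {2}t1 => H4; have := le_trans H1 H4.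
  by rewrite mulrAC ler_pdivlMr.
have H5 : K * (h x - h z) = 2 * (z - x) * C + (h x - h z).
  by rewrite /K; field; apply: lt0r_neq0; lra.
have H6 : (h x - h z) * (K * y `^ alpha) <= (h x - h z) * y by apply: ler_wpM2l => //; lra.
have H7 : 0 < (h x - h z) * y `^ alpha by apply: mulr_gt0; lra.
have H8 : (h x - h z) * y <= 2 * ((h x - h z) * (y - x)).
  have -> : (h x - h z) * y = 2 * ((h x - h z) * (y / 2)) by field.
  by rewrite ler_pM2l// ler_pM2l; lra.
have H9 : (h x - h z) * (K * y `^ alpha) = (2 * (z - x) * C + (h x - h z)) * y `^ alpha.
  by rewrite -H5; ring.
by lra.
Qed.

(** If [b <= 1], then [h(y) <= y^alpha ln(1 + 1/y) <= y^(alpha-1)], which tends to 0, against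
    [h(y) >= h(1) = ln(b + 1) > 0]. This is what makes the logarithm in [h] positive everywhere. *)
Lemma hfun_base_gt1 : 1 < b.
Proof.
rewrite ltNge; apply/negP => b1.
have l0 : 0 < ln (b + 1) by apply: ln_gt0; rewrite ltrDr.
have [y [_ y1 Ky]] := powR_sublinear (2 / ln (b + 1)) 1.
have y0 : 0 < y by lra.
have := @hfun_nondecreasing 1 y ltr01 y1.
rewrite !hfun_pos// one_powR mul1r invr1 leNgt => /negP; apply.
have yV : 0 < y^-1 by rewrite invr_gt0.
have H : ln (b + y^-1) <= y^-1.
  apply: (@le_trans _ _ (ln (1 + y^-1))); last by apply: le_ln1Dx; lra.
  by rewrite ler_ln ?posrE ?lerD2r ?addr_gt0.
have {}H : y `^ alpha * ln (b + y^-1) <= y `^ alpha * y^-1.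
  by apply: ler_wpM2l => //; exact: powR_ge0.
apply: (le_lt_trans H); rewrite ltr_pdivrMr//.
move: Ky; rewrite mulrAC ler_pdivrMr//.
by have := mulr_gt0 l0 y0; lra.
Qed.

Lemma hfun_ln_gt0 x : 0 < x -> 0 < ln (b + x^-1).
Proof.
move=> x0; apply: ln_gt0; have := hfun_base_gt1.
have : 0 < x^-1 by rewrite invr_gt0.
lra.
Qed.

Lemma hfun_gt0 x : x != 0 -> 0 < h x.
Proof.
move=> x0; rewrite -hfun_norm hfun_pos ?normr_gt0//.
by rewrite mulr_gt0 ?powR_gt0 ?normr_gt0// hfun_ln_gt0 ?normr_gt0.
Qed.

Lemma hfun_ge0 x : 0 <= h x.
Proof. by have [->|/hfun_gt0/ltW//] := eqVneq x 0; rewrite hfun0. Qed.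

Lemma ler_hfun x z : `|x| <= `|z| -> h x <= h z.
Proof.
have [->|x0] := eqVneq x 0; first by rewrite hfun0 hfun_ge0.
by move=> xz; rewrite -(hfun_norm x) -(hfun_norm z) hfun_nondecreasing ?normr_gt0.
Qed.

Lemma hfun_lt x z : h x < h z -> `|x| < `|z|.
Proof. by rewrite !ltNge; apply: contra; exact: ler_hfun. Qed.

(* h(x)/x = x^(alpha-1) ln(b + 1/x) is nonincreasing, hence h is subadditive. *)
Lemma hfunD_pos x y : 0 < x -> 0 < y -> h (x + y) <= h x + h y.
Proof.
have key u v : 0 < u -> 0 < v -> u / (u + v) * h (u + v) <= h u.
  move=> u0 v0; have uv0 : 0 < u + v by lra.
  rewrite !hfun_pos// mulrA.
  apply: ler_pM; [|exact: ltW (hfun_ln_gt0 _)| |].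
  - by rewrite mulr_ge0 ?powR_ge0// divr_ge0; lra.
  - have -> : u / (u + v) * (u + v) `^ alpha = u `^ alpha * (u / (u + v)) `^ (1 - alpha).
      have q0 : 0 < u / (u + v) by rewrite divr_gt0.
      have qE : u / (u + v) = (u / (u + v)) `^ alpha * (u / (u + v)) `^ (1 - alpha).
        by rewrite -powRD ?(gt_eqF q0) ?implybT// (addrC alpha) subrK powRr1// ltW.
      rewrite [X in X * _ = _]qE mulrAC -powRM ?(ltW q0) ?(ltW uv0)//.
      by rewrite divfK// gt_eqF.
    rewrite -[leRHS]mulr1; apply: ler_wpM2l; first exact: powR_ge0.
    rewrite [leRHS](_ : 1 = 1 `^ (1 - alpha)); last by rewrite one_powR.
    rewrite ge0_ler_powR ?nnegrE//.
    + by case/andP: alpha01; lra.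
    + by rewrite divr_ge0//; lra.
    + by rewrite ler_pdivrMr//; lra.
  - have vV : (u + v)^-1 <= u^-1 by rewrite lef_pV2 ?posrE//; lra.
    have uvV : 0 < (u + v)^-1 by rewrite invr_gt0.
    by rewrite ler_ln ?posrE ?lerD2l ?addr_gt0// invr_gt0.
move=> x0 y0; have xy0 : x + y != 0 by apply: lt0r_neq0; lra.
have -> : h (x + y) = x / (x + y) * h (x + y) + y / (y + x) * h (y + x).
  by rewrite (addrC y x); field.
by apply: lerD; exact: key.
Qed.

Lemma hfunD x y : h (x + y) <= h x + h y.
Proof.
have [->|x0] := eqVneq x 0; first by rewrite hfun0 !add0r.
have [->|y0] := eqVneq y 0; first by rewrite hfun0 !addr0.
rewrite -(hfun_norm x) -(hfun_norm y).
apply: le_trans (hfunD_pos _ _); rewrite ?normr_gt0//.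
by apply: ler_hfun; rewrite (le_trans (ler_normD _ _))// ler_norm.
Qed.

Lemma hfunN x : h (- x) = h x.
Proof. by rewrite -hfun_norm normrN hfun_norm. Qed.

Lemma ellalogB a c : ellalog alpha b a -> ellalog alpha b c ->
  cvgn (series (fun k => h (a k - c k))).
Proof.
rewrite /ellalog => ca cc; have cac := is_cvg_seriesD ca cc.
apply: (series_le_cvg _ _ _ cac) => k; first exact: hfun_ge0.
- by rewrite addr_ge0 ?hfun_ge0.
- by apply: (le_trans (hfunD _ _)); rewrite hfunN.
Qed.

Lemma hfun_le_ldist a c k : ellalog alpha b a -> ellalog alpha b c ->
  h (a k - c k) <= ldist alpha b a c.
Proof.
move=> /ellalogB ca /ca cac.
apply: (@le_trans _ _ (series (fun i => h (a i - c i)) k.+1)).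
  by rewrite seriesEord/= big_ord_recr /= lerDr sumr_ge0// => i _; exact: hfun_ge0.
by apply: nondecreasing_cvgn_le => //; apply: nondecreasing_series => *; exact: hfun_ge0.
Qed.

(** A single term of the series is at most the distance, and monotonicity of [h] allows it to be
    inverted, so the radius [h e] works. *)
Lemma coord_ld_cont A k : A `<=` ellalog alpha b -> ld_cont alpha b A (fun a => a k).
Proof.
move=> Al a Aa e e0; exists (h e); first by rewrite hfun_gt0// gt_eqF.
move=> c Ac dac; rewrite -(gtr0_norm e0); apply: hfun_lt.
by apply: le_lt_trans dac; apply: hfun_le_ldist; exact: Al.
Qed.

End Gauge.

(** * Tails and atoms from characteristic functions *)

Section Trigonometry.
Context {R : realType}.

Lemma sin_le_id (x : R) : 0 <= x -> sin x <= x.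
Proof.
rewrite le_eqVlt => /predU1P[<-|x0]; first by rewrite sin0.
have [c _] := @MVT R sin cos 0 x x0 (fun y _ => is_derive_sin y)
  (continuous_subspaceT (@continuous_sin R)).
rewrite sin0 !subr0 => ->.
by rewrite -[leRHS]mul1r ler_pM2r// cos_le1.
Qed.

Lemma cos_ge_quadratic (x : R) : 0 <= x -> 1 - x ^+ 2 / 2 <= cos x.
Proof.
move=> x0; rewrite {2}[x]splitr cosD -!expr2 cos2sin2.
suff : sin (x / 2) ^+ 2 <= (x / 2) ^+ 2 by rewrite expr_div_n; lra.
have x2 : 0 <= x / 2 by lra.
have : `|sin (x / 2)| <= x / 2.
  rewrite ler_norml sin_le_id// andbT.
  have [x1|x1] := leP (x / 2) 1; last by have := sin_geN1 (x / 2); lra.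
  have : 0 <= sin (x / 2).
    have [->|xn0] := eqVneq (x / 2) 0; first by rewrite sin0.
    apply/ltW/sin2_gt0/andP; split; last by lra.
    by rewrite lt0r xn0.
  lra.
move=> H; rewrite -(ger0_norm (sqr_ge0 (sin _))) normrX.
by rewrite ler_pXn2r ?nnegrE.
Qed.

(** The slope 7/8 is the value at 1/2 of the minorant [1 - x^2/2] of the cosine. *)
Lemma sin_ge_linear (y : R) : 0 <= y <= 1 / 2 -> 7 / 8 * y <= sin y.
Proof.
move=> /andP[]; rewrite le_eqVlt => /predU1P[<-|y0 y1]; first by rewrite mulr0 sin0.
have [c] := @MVT R sin cos 0 y y0 (fun y _ => is_derive_sin y)
  (continuous_subspaceT (@continuous_sin R)).
rewrite in_itv /= => /andP[c0 cy]; rewrite sin0 !subr0 => ->.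
rewrite ler_pM2r//; have := @cos_ge_quadratic c (ltW c0).
have : c * c <= 1 / 2 * (1 / 2) by apply: ler_pM; lra.
rewrite expr2; lra.
Qed.

(** The Dirichlet kernel at [2 y]: each [2 sin y cos(2 j y)] is [sin((2j+1) y) - sin((2j-1) y)], so
    the sum telescopes. *)
Lemma dirichlet_sum (N : nat) (y : R) :
  2 * sin y * \sum_(j < N) cos (j.+1%:R * 2 * y) = sin ((2 * N%:R + 1) * y) - sin y.
Proof.
elim: N => [|N IH]; first by rewrite big_ord0 !mulr0 add0r mul1r subrr.
rewrite big_ord_recr /= mulrDr IH.
have -> : (2 * N%:R + 1) * y = N.+1%:R * 2 * y - y by rewrite -natr1; ring.
have -> : (2 * N.+1%:R + 1) * y = N.+1%:R * 2 * y + y by ring.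
by rewrite sinB sinD; ring.
Qed.

(** The closed form gives [sin |x| * S <= 1/2], while the lower bound on [|x|] gives
    [(N+1) sin |x| >= 7/8]; the constant 4/7 is the quotient of the two. *)
Lemma cos_average_le (N : nat) (x : R) : N.+1%:R^-1 <= `|x| <= 1 / 2 ->
  \sum_(j < N.+1) cos (j.+1%:R * 2 * x) <= 4 / 7 * N.+1%:R.
Proof.
move=> /andP[x1 x2]; have n0 : 0 < N.+1%:R :> R by [].
have -> : \sum_(j < N.+1) cos (j.+1%:R * 2 * x) =
          \sum_(j < N.+1) cos (j.+1%:R * 2 * `|x|).
  apply: eq_bigr => j _; rewrite -[LHS]cos_norm normrM; congr (cos (_ * _)).
  by rewrite ger0_norm// mulr_ge0.
have sx : 7 / 8 * `|x| <= sin `|x| by apply: sin_ge_linear; rewrite normr_ge0.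
have nx : 1 <= N.+1%:R * `|x| by rewrite mulrC -ler_pdivrMr// div1r.
have x0 : 0 < `|x|.
  by apply: lt_le_trans x1; rewrite invr_gt0.
have D := dirichlet_sum N.+1 `|x|; set S := \sum_(j < _) _ in D *.
have s1 := @sin_le1 R ((2 * N.+1%:R + 1) * `|x|).
move: (sin ((2 * N.+1%:R + 1) * `|x|)) s1 D => s s1 D.
move: n0 nx D; set n : R := N.+1%:R; move=> n0 nx D.
have sx0 : 0 < sin `|x| by lra.
have H : sin `|x| * S <= 1 / 2 by lra.
have H2 : 1 <= 8 / 7 * (n * sin `|x|).
  have : n * (7 / 8 * `|x|) <= n * sin `|x| by rewrite ler_pM2l.
  lra.
rewrite -(ler_pM2l sx0); lra.
Qed.

End Trigonometry.

(** * Tail bound and absence of an atom at 0 *)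

Section CharacteristicFunctions.
Context {R : realType} {d : measure_display} {T : measurableType d}.
Variables (P : probability T R) (X : T -> R).
Hypothesis mX : measurable_fun setT X.

Lemma bounded_mfun_cos u : bounded_mfun (fun w => cos (u * X w)).
Proof.
split; last by exists 1 => w; exact: cos_max.
apply: measurableT_comp; first exact: continuous_measurable_fun (@continuous_cos R).
exact: measurable_funM.
Qed.

Lemma measurable_abs_ge x : measurable [set w | x <= `|X w|].
Proof.
rewrite -[X in measurable X]setTI.
by apply: measurable_fun_le => //; exact: measurableT_comp.
Qed.

(* The average of 1 - cos(2jX/(x(N+1))) over j <= N+1 is at least 3/7 on
   x <= |X| <= x(N+1)/2, by the closed form of the Dirichlet kernel. *)
Lemma cf_tail_truncated (alpha s x : R) (N : nat) : 0 < alpha < 1 -> 0 <= s -> 0 < x ->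
  (forall u, expR (- (s * `|u| `^ alpha)) <= \int[P]_w cos (u * X w)) ->
  fine (P [set w | x <= `|X w| <= x * N.+1%:R / 2]) <= 5 * (s * x `^ (- alpha)).
Proof.
move=> /andP[a0 a1] s0 x0 cfX; set A := [set w | _].
have n0 : 0 < N.+1%:R :> R by [].
have mA : measurable A.
  rewrite (_ : A = [set w | x <= `|X w|] `&` [set w | `|X w| <= x * N.+1%:R / 2]); last first.
    by apply/seteqP; split=> [w /andP[]//|w [/= xw wx]]; exact/andP.
  apply: measurableI; first exact: measurable_abs_ge.
  rewrite -[X in measurable X]setTI.
  by apply: measurable_fun_le => //; exact: measurableT_comp.
pose v (j : nat) := j.+1%:R * 2 / (x * N.+1%:R).
pose f w := \sum_(j < N.+1) (1 - cos (v j * X w)).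
have bf1 (j : nat) : bounded_mfun (fun w => 1 - cos (v j * X w)).
  under [X in bounded_mfun X]funext do rewrite -mulN1r.
  exact/bounded_mfunD/bounded_mfunZ/bounded_mfun_cos/bounded_mfun_cst.
have bf : bounded_mfun f by apply: bounded_mfun_sum.
have lowf w : 3 / 7 * N.+1%:R * \1_A w <= f w.
  have f0 : 0 <= f w.
    by apply: sumr_ge0 => j _; rewrite subr_ge0 cos_le1.
  rewrite indicE; case: (boolP (w \in A)) => [|_]; last by rewrite mulr0.
  rewrite inE /A /= => /andP[w1 w2]; rewrite mulr1.
  have yN : N.+1%:R^-1 <= `|X w / (x * N.+1%:R)| <= 1 / 2.
    rewrite normrM normfV (gtr0_norm (mulr_gt0 x0 n0)).
    rewrite ler_pdivlMr ?mulr_gt0// ler_pdivrMr ?mulr_gt0//.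
    rewrite mulrCA mulVf ?gt_eqF// mulr1 w1 /=; lra.
  have := cos_average_le yN.
  rewrite /f big_split /= sumr_const card_ord sumrN.
  have -> : \sum_(j < N.+1) cos (j.+1%:R * 2 * (X w / (x * N.+1%:R))) =
            \sum_(j < N.+1) cos (v j * X w).
    by apply: eq_bigr => j _; rewrite /v; congr cos; ring.
  lra.
have upf : \int[P]_w f w <= N.+1%:R * (2 * (s * x `^ (- alpha))).
  rewrite expect_sum//.
  apply: (@le_trans _ _ (\sum_(j < N.+1) 2 * (s * x `^ (- alpha)))); last first.
    by rewrite sumr_const card_ord [leRHS]mulr_natl.
  apply: ler_sum => j _.
  under eq_Rintegral do rewrite -mulN1r.
  rewrite expectD ?expect_cst ?expectZ; first last.
  - exact/bounded_mfunZ/bounded_mfun_cos.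
  - exact: bounded_mfun_cst.
  - exact: bounded_mfun_cos.
  have := cfX (v j); have := @expR_ge1Dx R (- (s * `|v j| `^ alpha)).
  suff : s * `|v j| `^ alpha <= 2 * (s * x `^ (- alpha)) by lra.
  rewrite mulrCA; apply: ler_wpM2l => //.
  have vj : `|v j| <= 2 * x^-1.
    have xN : 0 < x * N.+1%:R by exact: mulr_gt0.
    rewrite ger0_norm /v ?divr_ge0 ?(ltW xN)// ler_pdivrMr//.
    by rewrite -mulrA mulKf ?gt_eqF// mulrC ler_pM2l// ler_nat.
  apply: (@le_trans _ _ ((2 * x^-1) `^ alpha)).
    by rewrite ge0_ler_powR ?nnegrE ?(ltW a0)// mulr_ge0 ?invr_ge0 ?(ltW x0).
  rewrite powRM ?invr_ge0 ?(ltW x0)// powRN.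
  have -> : x^-1 `^ alpha = (x `^ alpha)^-1.
    by rewrite -[in LHS](powR_inv1 (ltW x0)) -powRrM mulN1r powRN.
  apply: ler_wpM2r; first by rewrite invr_ge0 powR_ge0.
  by apply: ler1_powR; lra.
have := le_expect P (bounded_mfunZ (3 / 7 * N.+1%:R) (bounded_mfun_indic mA)) bf lowf.
rewrite expectZ ?expect_indic//; last exact: bounded_mfun_indic.
move=> /le_trans/(_ upf); rewrite [X in X * _]mulrC -mulrA ler_pM2l//.
(* The average exceeds 1 - 4/7 = 3/7 on the event and its mean is at most twice the target quantity,
   so the true constant is 14/3, rounded up to 5. *)
have : 0 <= s * x `^ (- alpha) by rewrite mulr_ge0 ?powR_ge0.
lra.
Qed.

(** The truncated bound does not depend on [N], and the truncated events increase to the full tail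
    event. *)
Lemma cf_tail (alpha s x : R) : 0 < alpha < 1 -> 0 <= s -> 0 < x ->
  (forall u, expR (- (s * `|u| `^ alpha)) <= \int[P]_w cos (u * X w)) ->
  fine (P [set w | x <= `|X w|]) <= 5 * (s * x `^ (- alpha)).
Proof.
move=> a01 s0 x0 cfX.
pose A (N : nat) := [set w | x <= `|X w| <= x * N.+1%:R / 2].
have mA N : measurable (A N).
  rewrite (_ : A N = [set w | x <= `|X w|] `&` [set w | `|X w| <= x * N.+1%:R / 2]); last first.
    by apply/seteqP; split=> [w /andP[]//|w [/= xw wx]]; exact/andP.
  apply: measurableI; first exact: measurable_abs_ge.
  rewrite -[X in measurable X]setTI.
  by apply: measurable_fun_le => //; exact: measurableT_comp.
have AE : [set w | x <= `|X w|] = \bigcup_N A N.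
  apply/seteqP; split=> w /=; last by move=> [N _ /andP[]].
  move=> xw; exists (Num.truncn (2 * `|X w| / x)) => //; rewrite /A /= xw /=.
  have := truncnS_gt (2 * `|X w| / x); rewrite ltr_pdivrMr//; lra.
have ndA : nondecreasing_seq A.
  move=> n m nm; apply/subsetPset => w; rewrite /A /= => /andP[-> /le_trans]; apply.
  by rewrite ler_pM2r// ler_pM2l// ler_nat.
rewrite AE.
have := @nondecreasing_cvg_mu _ _ _ P A mA (bigcup_measurable (fun k _ => mA k)) ndA.
move=> PA; rewrite -lee_fin fineK ?fin_num_measure//; last exact: bigcup_measurable.
rewrite -(cvg_lim _ PA)//; apply: lime_le; first by apply/cvg_ex; eexists; exact: PA.
apply: nearW => N /=; rewrite -[leLHS]fineK ?fin_num_measure// lee_fin.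
exact: cf_tail_truncated.
Qed.

(* N^2 1{X = 0} is at most the Fejer sum of cos((j - l)uX) over j, l < N, whose
   mean is at most N + N^2 exp(-c u^a); let N and u tend to infinity. *)
Lemma cf_no_atom (a c : R) : 0 < a -> 0 < c ->
  (forall u, \int[P]_w cos (u * X w) <= expR (- (c * `|u| `^ a))) ->
  P [set w | X w = 0] = 0%E.
Proof.
move=> a0 c0 cfX; set A := [set w | X w = 0].
have mA : measurable A.
  by rewrite -[A]setTI; exact: mX (measurable_set1 0).
suff : fine (P A) <= 0.
  move=> H; rewrite -[LHS]fineK ?fin_num_measure//; congr EFin; apply/eqP.
  by rewrite eq_le H fine_ge0.
have bound (n : nat) : fine (P A) <= 2 / n.+1%:R.
  pose N := n.+1; have N0 : 0 < N%:R :> R by [].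
  (* This solves [c u^a = n], so the bound [exp(- c u^a)] is [exp(- n) <= 1/(n+1)], and all
     off-diagonal terms together contribute at most [N]. *)
  pose u := (n%:R / c) `^ a^-1.
  pose f w := \sum_(j < N) \sum_(l < N) cos ((j%:R - l%:R) * u * X w).
  (* Here [f] is the squared modulus of [sum_j exp(i j u X)]: nonnegative everywhere, and equal to
     [N^2] where [X = 0]. *)
  have fE w : f w = (\sum_(j < N) cos (j%:R * (u * X w))) ^+ 2 +
                    (\sum_(j < N) sin (j%:R * (u * X w))) ^+ 2.
    rewrite !expr2 !big_distrlr /= -big_split /=; apply: eq_bigr => j _.
    rewrite -big_split /=; apply: eq_bigr => l _.
    by rewrite -mulrA mulrBl cosB.
  have bf : bounded_mfun f.
    by do 2!(apply: bounded_mfun_sum => ? _); exact: bounded_mfun_cos.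
  have lowf w : N%:R ^+ 2 * \1_A w <= f w.
    rewrite indicE; case: (boolP (w \in A)) => [|_]; last first.
      by rewrite mulr0 fE addr_ge0// sqr_ge0.
    rewrite inE /A /= => Xw; rewrite mulr1 fE Xw !mulr0.
    under eq_bigr do rewrite mulr0 cos0.
    by rewrite sumr_const card_ord lerDl sqr_ge0.
  have eu : expR (- (c * u `^ a)) <= N%:R^-1.
    rewrite /u -powRrM mulVf ?gt_eqF// powRr1 ?divr_ge0 ?(ltW c0)//.
    rewrite mulrCA divff ?gt_eqF// mulr1 expRN lef_pV2 ?posrE ?expR_gt0//.
    by rewrite /N -natr1 addrC expR_ge1Dx.
  have upf : \int[P]_w f w <= N%:R + N%:R * (N%:R * N%:R^-1).
    rewrite expect_sum => [|j _]; last first.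
      by apply: bounded_mfun_sum => ? _; exact: bounded_mfun_cos.
    have -> : N%:R + N%:R * (N%:R * N%:R^-1) = \sum_(j < N) (1 + N%:R * N%:R^-1) :> R.
      by rewrite sumr_const card_ord -[RHS]mulr_natl mulrDr mulr1.
    apply: ler_sum => j _; rewrite expect_sum => [|l _]; last exact: bounded_mfun_cos.
    apply: (@le_trans _ _ (\sum_(l < N) ((l == j)%:R + N%:R^-1))); last first.
      rewrite big_split /= sumr_const card_ord
        (_ : N%:R^-1 *+ N = N%:R * N%:R^-1) ?lerD2r; last by rewrite mulr_natl.
      by rewrite (bigD1 j)//= eqxx big1 ?addr0// => i /negbTE ->.
    apply: ler_sum => l _; have := cfX ((j%:R - l%:R) * u).
    case: eqVneq => [->|lj].
      rewrite subrr mul0r normr0 powR0 ?gt_eqF// mulr0 oppr0 expR0 => H.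
      by apply: (le_trans H); rewrite lerDl invr_ge0.
    move=> /le_trans; apply; rewrite add0r; apply: le_trans eu.
    rewrite ler_expR lerN2 ler_pM2l// normrM (ger0_norm (powR_ge0 _ _ : 0 <= u)).
    rewrite powRM ?powR_ge0//  -[leLHS]mul1r; apply: ler_wpM2r; first exact: powR_ge0.
    rewrite -[leLHS](one_powR a) ge0_ler_powR ?nnegrE ?(ltW a0)//.
    have : (j != l :> nat) by rewrite eq_sym.
    rewrite neq_ltn => /orP[jl|jl].
      rewrite distrC ger0_norm ?subr_ge0 ?ler_nat ?(ltnW jl)// -natrB ?(ltnW jl)//.
      by rewrite ler1n subn_gt0.
    by rewrite ger0_norm ?subr_ge0 ?ler_nat ?(ltnW jl)// -natrB ?(ltnW jl)// ler1n subn_gt0.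
  have := le_expect P (bounded_mfunZ (N%:R ^+ 2) (bounded_mfun_indic mA)) bf lowf.
  rewrite expectZ ?expect_indic//; last exact: bounded_mfun_indic.
  move=> /le_trans/(_ upf); rewrite divff ?gt_eqF// mulr1 expr2 -mulrA.
  rewrite (_ : N%:R + N%:R = N%:R * 2 :> R); last by ring.
  by rewrite ler_pM2l// ler_pdivlMr// mulrC.
rewrite leNgt; apply/negP => p0.
have := bound (Num.truncn (2 / fine (P A))); rewrite ler_pdivlMr// leNgt => /negP; apply.
by have := truncnS_gt (2 / fine (P A)); rewrite ltr_pdivrMr// mulrC.
Qed.

End CharacteristicFunctions.

(** * Truncated moments of products *)

Section ProductMoment.
Context {R : realType}.
Local Notation mx1 x := (Num.max 1 `|x|).

Lemma dyadic_level (u : R) : 1 <= u -> exists I : nat, 2 ^+ I <= u < 2 ^+ I.+1.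
Proof.
move=> u1.
have ex : exists n : nat, u < 2 ^+ n.
  exists (Num.truncn u).+1; apply: lt_le_trans (truncnS_gt u) _.
  by rewrite -natrX ler_nat ltnW// ltn_expl.
have := ex_minnP ex; case=> [[|n]] un nmin; first by move: un; rewrite expr0 ltNge u1.
exists n; rewrite un andbT leNgt; apply/negP => /nmin.
by rewrite ltnn.
Qed.

(* With I, J the dyadic levels of max(1,|x|), max(1,|y|): level_count l x y is at
   least 1 as soon as l <= I + J, and its mean is at most C (l + 1) 2^(-alpha l)
   under the product tail bound. *)
Definition level_count (l : nat) (x y : R) : R :=
  \sum_(i < l.+1) ((2 ^+ i <= mx1 x) && (2 ^+ (l - i) <= mx1 y))%:R.

Lemma level_count_ge1 (i l : nat) (x y : R) : (i <= l)%N ->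
  2 ^+ i <= mx1 x -> 2 ^+ (l - i) <= mx1 y -> 1 <= level_count l x y.
Proof.
move=> il xi yj; have il' : (i < l.+1)%N by [].
rewrite /level_count (bigD1 (Ordinal il'))//= xi yj lerDl.
by apply: sumr_ge0 => j _; exact: ler0n.
Qed.

Lemma level_count_ge0 l (x y : R) : 0 <= level_count l x y.
Proof. by apply: sumr_ge0 => j _; exact: ler0n. Qed.

(** Let [I], [J] be the dyadic levels, so that [|x y| <= 4 * 2^(I+J)]. If [I + J <= L], the term
    [l = I + J] alone dominates. Otherwise some pair of levels with sum [L + 1] lies below [(I, J)],
    and the last count dominates the constant 1. *)
Lemma min1_prod_le (lam x y : R) (L : nat) : 0 <= lam ->
  Num.min 1 (lam * `|x * y|) <=
  \sum_(l < L.+1) 4 * lam * 2 ^+ l * level_count l x y + level_count L.+1 x y.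
Proof.
move=> lam0.
have x1 : 1 <= mx1 x by rewrite le_max lexx.
have y1 : 1 <= mx1 y by rewrite le_max lexx.
have [I /andP[I1 I2]] := dyadic_level x1; have [J /andP[J1 J2]] := dyadic_level y1.
have t0 (l : nat) : 0 <= 4 * lam * 2 ^+ l * level_count l x y.
  by rewrite !mulr_ge0 ?exprn_ge0// level_count_ge0.
have [IJ|IJ] := leqP (I + J) L.
  apply: (@le_trans _ _ (4 * lam * 2 ^+ (I + J) * level_count (I + J) x y)); last first.
    have IJ' : (I + J < L.+1)%N by [].
    rewrite (bigD1 (Ordinal IJ'))//= -addrA lerDl addr_ge0 ?level_count_ge0//.
    by apply: sumr_ge0 => j _.
  rewrite ge_min; apply/orP; right.
  have c1 : 1 <= level_count (I + J) x y.
    by apply: (@level_count_ge1 I); rewrite ?leq_addr ?addKn.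
  apply: (@le_trans _ _ (4 * lam * 2 ^+ (I + J) * 1)); last first.
    by apply: ler_wpM2l => //; rewrite !mulr_ge0 ?exprn_ge0.
  have xI : `|x| <= 2 ^+ I.+1 by apply: le_trans (ltW I2); rewrite le_max lexx orbT.
  have yJ : `|y| <= 2 ^+ J.+1 by apply: le_trans (ltW J2); rewrite le_max lexx orbT.
  have : `|x| * `|y| <= 2 ^+ I.+1 * 2 ^+ J.+1 by exact: ler_pM.
  move=> /(ler_wpM2l lam0) H; rewrite normrM; apply: (le_trans H).
  by rewrite !exprS exprD le_eqVlt; apply/orP; left; apply/eqP; ring.
apply: (@le_trans _ _ 1); first by rewrite ge_min lexx.
apply: (@le_trans _ _ (level_count L.+1 x y)); last first.
  by rewrite lerDr; apply: sumr_ge0 => j _.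
have lepow (m n : nat) : (m <= n)%N -> (2 : R) ^+ m <= 2 ^+ n.
  by move=> mn; rewrite ler_eXn2l// ltr1n.
(* With [i = min(I, L+1)], the complement [L + 1 - i] is at most [J] because [L < I + J]. *)
apply: (@level_count_ge1 (minn I L.+1)); first exact: geq_minr.
  by apply: le_trans I1; apply: lepow; exact: geq_minl.
by apply: le_trans J1; apply: lepow; lia.
Qed.

(** For use with [q = 2 * 2^(-alpha)], which exceeds 1 because [alpha < 1]: the sum is of the order
    of its last term. *)
Lemma geom_sum_le (q : R) (L : nat) : 1 < q ->
  \sum_(l < L.+1) q ^+ l <= q / (q - 1) * q ^+ L.
Proof.
move=> q1; have q0 : 0 < q - 1 by rewrite subr_gt0.
elim: L => [|L IH].
  by rewrite big_ord1 expr0 mulr1 ler_pdivlMr//; lra.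
rewrite big_ord_recr /=; have := IH; move: (\sum_(i < _) _) => S HS.
have -> : q / (q - 1) * q ^+ L.+1 = q / (q - 1) * q ^+ L + q ^+ L.+1.
  by rewrite exprS; field; exact: lt0r_neq0.
by rewrite lerD2r.
Qed.

Lemma ln2_ge_half : 1 / 2 <= ln 2 :> R.
Proof.
have := @le_ln1Dx R (- (1 / 2)); have -> : 1 + - (1 / 2) = 2^-1 :> R by field.
rewrite lnV ?posrE// => /(_ _); lra.
Qed.

(** The quotient is the geometric-sum constant for ratio [2 beta]. The inner 4 comes from
    [|x y| <= 4 * 2^(I+J)], the [+ 1] from the overflow level, and the outer 4 from the two
    roundings [beta^L <= 2 lam^alpha] and [L + 2 <= 2 (1 - ln lam)]. *)
Definition moment_const (alpha : R) : R :=
  let beta := 2 `^ (- alpha) in 4 * (4 * (2 * beta / (2 * beta - 1)) + 1).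

Lemma moment_const_ge0 (alpha : R) : 0 < alpha < 1 ->
  1 < 2 * 2 `^ (- alpha) /\ 0 <= moment_const alpha.
Proof.
move=> /andP[a0 a1].
have b1 : 1 < 2 * 2 `^ (- alpha) :> R.
  rewrite -{1}[2]powRr1// -powRD ?pnatr_eq0 ?implybT//.
  rewrite -[ltLHS](powRr0 2) /powR pnatr_eq0 /= ltr_expR ltr_pM2r; first by lra.
  by have := ln2_ge_half; lra.
split => //; have k0 : 0 <= 2 * 2 `^ (- alpha) / (2 * 2 `^ (- alpha) - 1) :> R.
  by rewrite divr_ge0 ?mulr_ge0 ?powR_ge0// subr_ge0 ltW.
by rewrite /moment_const mulr_ge0// addr_ge0// mulr_ge0.
Qed.

Lemma measurable_half_level (d : measure_display) (T : measurableType d) (X : T -> R) (k : nat) :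
  measurable_fun setT X ->
  measurable [set w | 2 ^+ k <= mx1 (X w)].
Proof.
move=> mX; rewrite -[X in measurable X]setTI.
apply: measurable_fun_le => //; apply: measurable_maxr => //.
exact: measurableT_comp.
Qed.

Section Moment.
Context {d : measure_display} {T : measurableType d} (P : probability T R).
Variables (X Y : T -> R).
Hypotheses (mX : measurable_fun setT X) (mY : measurable_fun setT Y).

Let lev (i j : nat) := [set w | (2 ^+ i <= mx1 (X w)) && (2 ^+ j <= mx1 (Y w))].

Lemma measurable_level i j : measurable (lev i j).
Proof.
rewrite (_ : lev i j = [set w | 2 ^+ i <= mx1 (X w)] `&` [set w | 2 ^+ j <= mx1 (Y w)]).
  by apply: measurableI; exact: measurable_half_level.
by apply/seteqP; split=> [w /andP[]//|w [/= xw wx]]; exact/andP.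
Qed.

Lemma bounded_mfun_min1 (lam : R) : 0 <= lam ->
  bounded_mfun (fun w => Num.min 1 (lam * `|X w * Y w|)).
Proof.
move=> lam0; split.
  apply: measurable_minr => //; apply: measurable_funM => //.
  by apply: measurableT_comp => //; exact: measurable_funM.
exists 1 => w; rewrite ger0_norm ?ge_min ?lexx// le_min ler01 /=.
exact: mulr_ge0.
Qed.

(** The cut-off level is the [L] with [2^L <= 1/lam < 2^(L+1)]. The levels up to [L] form a growing
    geometric sum, and the overflow level has the same order [(L+2) beta^L]. The factor [L + 2],
    which counts pairs of levels with a given sum, is the source of the logarithm. Assuming joint
    level tails instead of independence also admits a constant second factor. *)
Lemma expect_min1_prod (alpha C lam : R) : 0 < alpha < 1 -> 0 <= C ->
  (forall i j, fine (P (lev i j)) <= C * (2 `^ (- alpha)) ^+ (i + j)) ->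
  0 < lam <= 1 ->
  \int[P]_w Num.min 1 (lam * `|X w * Y w|) <=
  moment_const alpha * C * (lam `^ alpha * (1 - ln lam)).
Proof.
move=> a01 C0 tail /andP[l0 l1]; have [b1 _] := moment_const_ge0 a01.
rewrite /moment_const; set beta := 2 `^ (- alpha) in tail b1 *.
have [a0 a1] := andP a01.
have beta0 : 0 < beta by rewrite powR_gt0.
have lV : 1 <= lam^-1 by rewrite invf_ge1.
have [L /andP[L1 L2]] := dyadic_level lV.
pose kap := 2 * beta / (2 * beta - 1).
have kap0 : 0 <= kap by rewrite divr_ge0//; lra.
have bind i j : bounded_mfun (fun w => ((2 ^+ i <= mx1 (X w)) && (2 ^+ j <= mx1 (Y w)))%:R : R).
  have := @bounded_mfun_indic R _ _ _ (measurable_level i j); congr bounded_mfun.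
  apply/funext => w; rewrite indicE; congr (_%:R).
  by rewrite /lev mem_setE.
have eind i j : \int[P]_w (((2 ^+ i <= mx1 (X w)) && (2 ^+ j <= mx1 (Y w)))%:R : R)
    <= C * beta ^+ (i + j).
  apply: le_trans (tail i j); rewrite -expect_indic; last exact: measurable_level.
  rewrite le_eqVlt; apply/orP; left; apply/eqP; apply: eq_Rintegral => w _.
  by rewrite indicE /lev mem_setE.
have blc l : bounded_mfun (fun w => level_count l (X w) (Y w)).
  by apply: bounded_mfun_sum => i _.
have elc (l : nat) : \int[P]_w level_count l (X w) (Y w) <= C * (l.+1%:R * beta ^+ l).
  rewrite /level_count expect_sum//.
  apply: (@le_trans _ _ (\sum_(i < l.+1) C * beta ^+ l)); last first.
    by rewrite sumr_const card_ord mulrCA [leRHS]mulr_natl.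
  apply: ler_sum => i _; apply: (le_trans (eind _ _)).
  by rewrite subnKC// -ltnS.
apply: (@le_trans _ _ (\int[P]_w (\sum_(l < L.+1) 4 * lam * 2 ^+ l *
    level_count l (X w) (Y w) + level_count L.+1 (X w) (Y w)))).
  apply: le_expect; first exact/bounded_mfun_min1/ltW.
  - apply: bounded_mfunD; last exact: blc.
    by apply: bounded_mfun_sum => l _; exact: bounded_mfunZ.
  - by move=> w; apply: min1_prod_le; exact: ltW.
rewrite expectD; [|by apply: bounded_mfun_sum => l _; exact: bounded_mfunZ|exact: blc].
rewrite expect_sum; last by move=> l _; exact: bounded_mfunZ.
have S1 : \sum_(l < L.+1) \int[P]_w (4 * lam * 2 ^+ l * level_count l (X w) (Y w)) <=
    4 * (C * (L.+2%:R * (kap * beta ^+ L))).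
  apply: (@le_trans _ _ (\sum_(l < L.+1) 4 * (C * (L.+2%:R * (lam * (2 * beta) ^+ l))))).
    apply: ler_sum => l _; rewrite expectZ//.
    apply: (@le_trans _ _ (4 * lam * 2 ^+ l * (C * (L.+2%:R * beta ^+ l)))).
      apply: ler_wpM2l; first by rewrite !mulr_ge0 ?exprn_ge0// ltW.
      apply: (le_trans (elc _)); apply: ler_wpM2l => //; apply: ler_wpM2r.
        by rewrite exprn_ge0// ltW.
      by rewrite ler_nat ltnS ltnW.
    by rewrite exprMn le_eqVlt; apply/orP; left; apply/eqP; ring.
  rewrite -!mulr_sumr; do 3!(apply: ler_wpM2l => //).
  apply: (@le_trans _ _ (lam * (kap * (2 * beta) ^+ L))).
    by apply: ler_wpM2l; [exact: ltW|exact: geom_sum_le].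
  rewrite mulrCA; apply: ler_wpM2l => //; rewrite exprMn mulrA.
  rewrite -[leRHS]mul1r; apply: ler_wpM2r; first by rewrite exprn_ge0// ltW.
  by rewrite mulrC -ler_pdivlMr// div1r.
have S2 : \int[P]_w level_count L.+1 (X w) (Y w) <= C * (L.+2%:R * beta ^+ L).
  apply: (le_trans (elc _)); apply: ler_wpM2l => //; apply: ler_wpM2l => //.
  rewrite exprS -[leRHS]mul1r; apply: ler_wpM2r; first by rewrite exprn_ge0// ltW.
  rewrite /beta powRN invf_le1 ?powR_gt0// [leLHS](_ : 1 = 2 `^ 0); last by rewrite powRr0.
  by rewrite ler_powR ?ler1n// ltW.
apply: (le_trans (lerD S1 S2)).
(* From [1/lam < 2^(L+1)], that is [2^(-L) < 2 lam], together with [2^alpha <= 2]. *)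
have bL : beta ^+ L <= 2 * lam `^ alpha.
  rewrite /beta -powR_mulrn ?powR_ge0// -powRrM.
  have -> : 2 `^ (- alpha * L%:R) = (2 ^+ L)^-1 `^ alpha :> R.
    by rewrite -powR_mulrn// -powRN -powRrM; congr (_ `^ _); ring.
  apply: (@le_trans _ _ ((2 * lam) `^ alpha)).
    rewrite ge0_ler_powR ?nnegrE ?(ltW a0)//.
      by rewrite mulr_ge0// ltW.
    rewrite -div1r ler_pdivrMr ?exprn_gt0// -mulrA mulrCA -exprS mulrC.
    by rewrite -ler_pdivrMr// div1r ltW.
  rewrite powRM ?(ltW l0)//; apply: ler_wpM2r; first exact: powR_ge0.
  by apply: ler1_powR; [rewrite ler1n|exact: ltW].
(* Here [2^L <= 1/lam] bounds [L ln 2] by [- ln lam], and [ln 2 >= 1/2]. *)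
have LL : L.+2%:R <= 2 * (1 - ln lam).
  have : ln (2 ^+ L) <= ln lam^-1 :> R by rewrite ler_ln ?posrE ?exprn_gt0 ?invr_gt0.
  rewrite lnXn// lnV ?posrE// (_ : ln 2 *+ L = ln 2 * L%:R); last by rewrite mulr_natr.
  have -> : L.+2%:R = L%:R + 2 :> R by rewrite -addn2 natrD.
  have : 1 / 2 * L%:R <= ln 2 * L%:R :> R by apply: ler_wpM2r => //; exact: ln2_ge_half.
  lra.
have G : L.+2%:R * beta ^+ L <= 2 * (1 - ln lam) * (2 * lam `^ alpha).
  by apply: ler_pM => //; rewrite exprn_ge0// ltW.
have {}G : (4 * kap + 1) * C * (L.+2%:R * beta ^+ L) <=
    (4 * kap + 1) * C * (2 * (1 - ln lam) * (2 * lam `^ alpha)).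
  by apply: ler_wpM2l => //; rewrite mulr_ge0//; lra.
rewrite -/kap; apply: le_trans (le_trans G _).
  by rewrite le_eqVlt; apply/orP; left; apply/eqP; ring.
by rewrite le_eqVlt; apply/orP; left; apply/eqP; ring.
Qed.

End Moment.
End ProductMoment.

(** * Truncated moments of stable variables *)

Section Tails.
Context {R : realType} {d : measure_display} {T : measurableType d}.
Variable P : probability T R.
Local Notation mx1 x := (Num.max 1 `|x|).

(** The condition [1 <= C] pays for level 0, where the maximum with 1 makes the event certain; at
    higher levels that maximum has no effect. *)
Lemma level_tail (X : T -> R) (alpha C : R) (i : nat) : measurable_fun setT X -> 1 <= C ->
  (forall x, 0 < x -> fine (P [set w | x <= `|X w|]) <= C * x `^ (- alpha)) ->
  fine (P [set w | 2 ^+ i <= mx1 (X w)]) <= C * (2 `^ (- alpha)) ^+ i.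
Proof.
move=> mX C1 tail; case: i => [|i].
  rewrite expr0 mulr1; apply: le_trans C1.
  rewrite -lee_fin fineK ?fin_num_measure ?probability_le1//; exact: (measurable_half_level 0 mX).
have -> : [set w | 2 ^+ i.+1 <= mx1 (X w)] = [set w | 2 ^+ i.+1 <= `|X w|].
  apply/seteqP; split=> w /=; rewrite le_max; last by move=> ->; rewrite orbT.
  by rewrite leNgt exprn_egt1// ltr1n.
have -> : (2 `^ (- alpha)) ^+ i.+1 = (2 ^+ i.+1) `^ (- alpha) :> R.
  by rewrite -powR_mulrn ?powR_ge0// -[in RHS]powR_mulrn// -!powRrM mulrC.
by apply: tail; exact: exprn_gt0.
Qed.

Lemma indep_level_tail (X Y : T -> R) (alpha C : R) (i j : nat) :
  measurable_fun setT X -> measurable_fun setT Y -> 1 <= C ->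
  (forall A B : set R, measurable A -> measurable B ->
     P (X @^-1` A `&` Y @^-1` B) = (P (X @^-1` A) * P (Y @^-1` B))%E) ->
  (forall x, 0 < x -> fine (P [set w | x <= `|X w|]) <= C * x `^ (- alpha)) ->
  (forall x, 0 < x -> fine (P [set w | x <= `|Y w|]) <= C * x `^ (- alpha)) ->
  fine (P [set w | (2 ^+ i <= mx1 (X w)) && (2 ^+ j <= mx1 (Y w))]) <=
    C ^+ 2 * (2 `^ (- alpha)) ^+ (i + j).
Proof.
move=> mX mY C1 ind tX tY.
have mlev k : measurable [set x : R | 2 ^+ k <= mx1 x].
  rewrite -[X in measurable X]setTI.
  by apply: measurable_fun_le => //; exact: measurable_maxr.
have -> : [set w | (2 ^+ i <= mx1 (X w)) && (2 ^+ j <= mx1 (Y w))] =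
    X @^-1` [set x | 2 ^+ i <= mx1 x] `&` Y @^-1` [set x | 2 ^+ j <= mx1 x].
  by apply/seteqP; split=> [w /andP[]//|w [/= xw wx]]; exact/andP.
rewrite ind// fineM ?fin_num_measure//; [|exact: measurable_half_level..].
have -> : C ^+ 2 * (2 `^ (- alpha)) ^+ (i + j) =
    (C * (2 `^ (- alpha)) ^+ i) * (C * (2 `^ (- alpha)) ^+ j) by rewrite exprD; ring.
by apply: ler_pM; rewrite ?fine_ge0//; exact: level_tail.
Qed.

Lemma mutual_indep_pair (X : nat -> T -> R) (t u : nat) (A B : set R) :
  mutual_indep P X -> t != u -> measurable A -> measurable B ->
  P (X t @^-1` A `&` X u @^-1` B) = (P (X t @^-1` A) * P (X u @^-1` B))%E.
Proof.
move=> ind tu mA mB.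
have := ind [:: t; u] (fun k => if k == t then A else B).
rewrite /= inE tu => /(_ erefl (fun k => ltac:(by case: ifP))).
rewrite !big_cons big_nil mule1 eqxx eq_sym (negbTE tu) => <-; congr (P _).
apply/seteqP; split=> [w [/= Aw Bw] k /=|w H].
  by rewrite !inE => /orP[]/eqP ->; rewrite ?eqxx// eq_sym (negbTE tu).
split.
  by have := H t; rewrite /= !inE eqxx => /(_ isT).
by have := H u; rewrite /= !inE eqxx orbT eq_sym (negbTE tu) => /(_ isT).
Qed.

Lemma has_cf_re (X : T -> R) (phr phi : R -> R) u : has_cf P X phr phi ->
  \int[P]_w cos (u * X w) = phr u.
Proof. by move=> /(_ u)[cfX _]; rewrite /Rintegral cfX. Qed.

(** The norming [c = (n ln n)^(1/alpha)] exactly balances the product estimate at [lam = s / c]: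
    [lam^alpha] is [s^alpha / (n ln n)], and [1 - ln lam] costs at most
    [(1 + 2/alpha) (1 - ln s) ln n], since [ln c <= (2/alpha) ln n]. The factor 25 is the square of
    the tail constant 5. *)
Lemma stable_noise_moment (eps : nat -> T -> R) (alpha s : R) (n t u : nat) :
  0 < alpha < 1 -> (forall t, measurable_fun setT (eps t)) -> mutual_indep P eps ->
  (forall t, has_cf P (eps t) (fun u => expR (- `|u| `^ alpha)) (fun=> 0)) ->
  t != u -> 0 < s <= 1 -> 1 <= ln n%:R :> R ->
  n%:R * \int[P]_w Num.min 1 (s / (n%:R * ln n%:R) `^ alpha^-1 * `|eps t w * eps u w|) <=
  moment_const alpha * 25 * (1 + 2 / alpha) * (s `^ alpha * (1 - ln s)).
Proof.
move=> a01 meps ind cfe tu /andP[s0 s1] ln1; have [a0 a1] := andP a01.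
have [_ mc0] := moment_const_ge0 a01.
have n0 : 0 < n%:R :> R.
  by rewrite lt_neqAle ler0n andbT; apply: contraTneq ln1 => <-; rewrite ln0// -ltNge.
have n1 : 1 <= n%:R :> R by move: n0; rewrite ltr0n ler1n.
have nl1 : 1 <= n%:R * ln n%:R :> R by rewrite -[leLHS]mulr1 ler_pM.
set c := (n%:R * ln n%:R) `^ alpha^-1.
have c1 : 1 <= c.
  rewrite [leLHS](_ : 1 = 1 `^ alpha^-1); last by rewrite one_powR.
  by rewrite ge0_ler_powR ?nnegrE ?invr_ge0 ?(ltW a0)// (le_trans ler01).
have c0 : 0 < c by lra.
have tail k x : 0 < x -> fine (P [set w | x <= `|eps k w|]) <= 5 * x `^ (- alpha).
  move=> x0; rewrite -[x `^ _]mul1r; apply: cf_tail => // v.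
  by rewrite (has_cf_re v (cfe k)) mul1r.
have lam01 : 0 < s / c <= 1 by rewrite divr_gt0//= ler_pdivrMr// mul1r (le_trans s1).
have C1 : (1 : R) <= 5 by rewrite ler1n.
have ind2 A B : measurable A -> measurable B ->
    P (eps t @^-1` A `&` eps u @^-1` B) = (P (eps t @^-1` A) * P (eps u @^-1` B))%E.
  by move=> mA mB; exact: mutual_indep_pair.
have H := expect_min1_prod (meps t) (meps u) a01 (sqr_ge0 5)
  (fun i j => indep_level_tail i j (meps t) (meps u) C1 ind2 (tail t) (tail u)) lam01.
apply: (@le_trans _ _ (n%:R * (moment_const alpha * 5 ^+ 2 *
    ((s / c) `^ alpha * (1 - ln (s / c)))))); first by apply: ler_wpM2l => //; exact: ltW.
have -> : (s / c) `^ alpha = s `^ alpha / (n%:R * ln n%:R).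
  rewrite powRM ?invr_ge0 ?(ltW s0) ?(ltW c0)//; congr (_ * _).
  rewrite -[c^-1](powR_inv1 (ltW c0)) -powRrM mulN1r powRN /c -powRrM mulVf ?gt_eqF//.
  by rewrite powRr1// (le_trans _ nl1).
have lnc : ln c <= 2 / alpha * ln n%:R.
  rewrite /c ln_powR mulrC lnM ?posrE//; last by lra.
  have : ln (ln n%:R) <= ln n%:R :> R by apply/ltW/ln_sublinear; lra.
  move=> H1; rewrite -mulrA (mulrC alpha^-1) mulrA ler_pM2r ?invr_gt0//; lra.
rewrite ln_div ?posrE//.
have lns : ln s <= 0 by exact: ln_le0.
have G : 1 - (ln s - ln c) <= (1 + 2 / alpha) * (1 - ln s) * ln n%:R.
  set L := ln n%:R in ln1 lnc *; set q := 2 / alpha in lnc *.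
  have q0 : 0 < q by rewrite divr_gt0.
  have : 0 <= (1 + q) * (- ln s) * (L - 1) by rewrite !mulr_ge0//; lra.
  have : 0 <= q * (- ln s) by rewrite mulr_ge0//; lra.
  nra.
have -> : n%:R * (moment_const alpha * 5 ^+ 2 *
    (s `^ alpha / (n%:R * ln n%:R) * (1 - (ln s - ln c)))) =
  moment_const alpha * 25 * s `^ alpha * ((1 - (ln s - ln c)) / ln n%:R).
  by field; rewrite !gt_eqF//; lra.
have -> : moment_const alpha * 25 * (1 + 2 / alpha) * (s `^ alpha * (1 - ln s)) =
  moment_const alpha * 25 * s `^ alpha * ((1 + 2 / alpha) * (1 - ln s)) by ring.
apply: ler_wpM2l; first by apply: mulr_ge0; [exact: mulr_ge0|exact: powR_ge0].
by rewrite ler_pdivrMr//; lra.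
Qed.

(** The product estimate with second factor 1, whose levels above 0 are empty. The [+ 1] makes the
    tail constant at least 1, and the factor [1 - ln s] is harmless because the weights are summable
    with it. *)
Lemma stable_min1_moment (X : T -> R) (alpha c s : R) :
  0 < alpha < 1 -> 0 <= c -> measurable_fun setT X ->
  (forall u, expR (- (c * `|u| `^ alpha)) <= \int[P]_w cos (u * X w)) ->
  0 < s <= 1 ->
  \int[P]_w Num.min 1 (s * `|X w|) <=
  moment_const alpha * (5 * c + 1) * (s `^ alpha * (1 - ln s)).
Proof.
move=> a01 c0 mX cfX s01.
have tail x : 0 < x -> fine (P [set w | x <= `|X w|]) <= (5 * c + 1) * x `^ (- alpha).
  move=> x0; apply: (le_trans (cf_tail mX a01 c0 x0 cfX)); rewrite mulrA.
  by apply: ler_wpM2r; [exact: powR_ge0|rewrite lerDl].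
have C1 : 1 <= 5 * c + 1 by rewrite lerDr mulr_ge0.
have -> : \int[P]_w Num.min 1 (s * `|X w|) = \int[P]_w Num.min 1 (s * `|X w * 1|).
  by apply: eq_Rintegral => w _; rewrite mulr1.
apply: (@expect_min1_prod _ _ _ P X (fun=> 1)) => // [|i [|j]].
- by lra.
- rewrite addn0; apply: le_trans (level_tail i mX C1 tail).
  rewrite le_eqVlt; apply/orP; left; apply/eqP; congr (fine (P _)).
  apply/seteqP; split=> w /=; first by case/andP.
  by move=> ->; rewrite expr0 le_max lexx.
- rewrite (_ : mkset _ = set0) ?measure0 /=; last first.
    apply/seteqP; split=> w //= /andP[_].
    by rewrite normr1 maxxx leNgt exprn_egt1// ltr1n.
  by rewrite mulr_ge0 ?exprn_ge0 ?powR_ge0//; lra.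
Qed.

End Tails.

(** * Weak convergence of linear forms *)

Section UniformContinuityMaps.
Context {R : realType}.
Variables (alpha b : R) (A : set (nat -> R)).
Local Notation cont := (ld_cont alpha b A).
Implicit Types (f g : (nat -> R) -> R) (F : ((nat -> R) -> R) -> R).

Lemma ld_cont_cst (c : R) : cont (fun=> c).
Proof. by move=> a Aa e e0; exists 1 => // x _ _; rewrite subrr normr0. Qed.

Lemma ld_contD f g : cont f -> cont g -> cont (fun a => f a + g a).
Proof.
move=> cf cg a Aa e e0; have e2 : 0 < e / 2 by lra.
have [r r0 fr] := cf a Aa _ e2; have [s s0 gs] := cg a Aa _ e2.
exists (Num.min r s); first by rewrite lt_min r0.
move=> x Ax; rewrite lt_min => /andP[/(fr x Ax) fx /(gs x Ax) gx].
rewrite opprD addrACA (le_lt_trans (ler_normD _ _))//; lra.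
Qed.

Lemma ld_contM_cst f (c : R) : cont f -> cont (fun a => f a * c).
Proof.
move=> cf a Aa e e0; have c0 : 0 < `|c| + 1 by rewrite ltr_wpDl.
have [r r0 fr] := cf a Aa (e / (`|c| + 1)) (divr_gt0 e0 c0).
exists r => // x Ax /(fr x Ax); rewrite ltr_pdivlMr// => H.
rewrite -mulrBl normrM; apply: le_lt_trans H; apply: ler_wpM2l => //.
by rewrite lerDl.
Qed.

Lemma ld_cont_uniform_limit f :
  (forall e : R, 0 < e -> exists2 g, cont g & forall a, A a -> `|f a - g a| <= e) -> cont f.
Proof.
move=> fg a Aa e e0; have e3 : 0 < e / 3 by lra.
have [g cg gf] := fg _ e3; have [r r0 gr] := cg a Aa _ e3.
exists r => // x Ax /(gr x Ax); have := gf a Aa; have := gf x Ax.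
rewrite !ler_norml !ltr_norml => /andP[? ?] /andP[? ?] /andP[? ?].
by apply/andP; split; lra.
Qed.

Definition bounded_on_cont F := exists M : R, forall f, cont f -> `|F f| <= M.

Definition cont_functional F := forall f, cont f -> forall e : R, 0 < e ->
  exists2 r : R, 0 < r & forall g, cont g ->
    (forall a, A a -> `|f a - g a| <= r) -> `|F f - F g| < e.

Definition ucont_functional F := forall e : R, 0 < e ->
  exists2 r : R, 0 < r & forall f g, cont f -> cont g ->
    (forall a, A a -> `|f a - g a| <= r) -> `|F f - F g| < e.

Lemma ucont_functional_cont F : ucont_functional F -> cont_functional F.
Proof. by move=> uF f cf e /uF[r r0 h]; exists r => // g cg; exact: h. Qed.

(* These minorants increase to F as L grows, so that weak convergence only has
   to be checked on uniformly continuous functionals, applied to F and - F. *)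
Definition lipschitz_minorant (L : R) F f : R :=
  inf [set x | exists g r, [/\ cont g, 0 <= r,
    forall a, A a -> `|f a - g a| <= r & x = F g + L * r]].

Section Minorant.
Variables (F : ((nat -> R) -> R) -> R) (M : R).
Hypothesis FM : forall f, cont f -> `|F f| <= M.

Let adm L f := [set x | exists g r, [/\ cont g, 0 <= r,
    forall a, A a -> `|f a - g a| <= r & x = F g + L * r]].

Let admFf L f : cont f -> adm L f (F f).
Proof.
move=> cf; exists f, 0; split => // [a _|]; first by rewrite subrr normr0.
by rewrite mulr0 addr0.
Qed.

Let adm_lb L f : 0 <= L -> lbound (adm L f) (- M).
Proof.
move=> L0 x [g [r [cg r0 _ ->]]]; have /ler_normlP[] := FM cg.
by have : 0 <= L * r by [exact: mulr_ge0]; lra.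
Qed.

Lemma lipschitz_minorant_le L f : 0 <= L -> cont f -> lipschitz_minorant L F f <= F f.
Proof.
move=> L0 cf; apply: ge_inf; last exact: admFf.
by exists (- M); exact: adm_lb.
Qed.

Lemma lipschitz_minorant_bound L f : 0 <= L -> cont f -> `|lipschitz_minorant L F f| <= M.
Proof.
move=> L0 cf; rewrite ler_norml; apply/andP; split.
  by apply: lb_le_inf; [exists (F f); exact: admFf|exact: adm_lb].
by apply: (le_trans (lipschitz_minorant_le L0 cf)); have /ler_normlP[] := FM cf.
Qed.

(** A competitor [(u, s)] for [g] is a competitor [(u, s + r)] for [f]. Letting the radius be any
    upper bound of the distance avoids forming a supremum over [A]. *)
Lemma lipschitz_minorant_lip L f g (r : R) : 0 <= L -> 0 <= r -> cont f -> cont g ->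
  (forall a, A a -> `|f a - g a| <= r) ->
  lipschitz_minorant L F f <= lipschitz_minorant L F g + L * r.
Proof.
move=> L0 r0 cf cg fg; rewrite -lerBlDr.
apply: lb_le_inf; first by exists (F g); exact: admFf.
move=> _ [u [s [cu s0 gu ->]]]; rewrite lerBlDr -addrA -mulrDr.
apply: ge_inf; first by exists (- M); exact: adm_lb.
exists u, (s + r); split => //; first exact: addr_ge0.
move=> a Aa; have -> : f a - u a = (g a - u a) + (f a - g a) by ring.
by rewrite (le_trans (ler_normD _ _))// lerD ?gu ?fg.
Qed.

Lemma lipschitz_minorant_ucont L : 0 <= L -> ucont_functional (lipschitz_minorant L F).
Proof.
move=> L0 e e0; have L1 : 0 < L + 1 by lra.
exists (e / (L + 1)); first exact: divr_gt0.
move=> f g cf cg fg.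
have r0 : 0 <= e / (L + 1) by exact/ltW/divr_gt0.
have gf a : A a -> `|g a - f a| <= e / (L + 1) by move=> /fg; rewrite distrC.
have h1 := lipschitz_minorant_lip L0 r0 cf cg fg.
have h2 := lipschitz_minorant_lip L0 r0 cg cf gf.
have : L * (e / (L + 1)) < e.
  by rewrite mulrA ltr_pdivrMr// mulrC ltr_pM2l//; lra.
by move: (L * (e / (L + 1))) h1 h2 => x h1 h2 xe; rewrite ltr_norml; apply/andP; split; lra.
Qed.

(** Competitors within [r] of [f] change [F] by less than [e]; those farther away pay [n r >= 2 M]
    for large [n] and cannot undercut [F f]. *)
Lemma lipschitz_minorant_cvg f : cont_functional F -> cont f ->
  (fun n => lipschitz_minorant n%:R F f) @ \oo --> F f.
Proof.
move=> cF cf; apply/cvgrPdist_le => e e0.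
have [r r0 fr] := cF f cf e e0.
near=> n.
have n0 : 0 <= n%:R :> R by [].
have up := lipschitz_minorant_le n0 cf.
suff lo : F f - e <= lipschitz_minorant n%:R F f.
  by rewrite ler_norml; apply/andP; split; lra.
apply: lb_le_inf; first by exists (F f); exact: admFf.
move=> _ [g [s [cg s0 fg ->]]].
have ns : 0 <= n%:R * s by exact: mulr_ge0.
have [sr|rs] := leP s r.
  have := fr g cg (fun a Aa => le_trans (fg a Aa) sr).
  by rewrite ltr_norml => /andP[]; lra.
have /ler_normlP[f1 f2] := FM cf; have /ler_normlP[g1 g2] := FM cg.
have nr : 2 * M / r <= n%:R by near: n; exact: nbhs_infty_ger.
have : n%:R * r <= n%:R * s by apply: ler_wpM2l => //; exact: ltW.
by move: nr; rewrite ler_pdivrMr//; lra.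
Unshelve. all: by end_near. Qed.

End Minorant.
End UniformContinuityMaps.

Section WeakConvergence.
Context {R : realType}.
Variables (alpha b : R) (A : set (nat -> R)) (rad : nat -> R).
Local Notation cont := (ld_cont alpha b A).
Hypothesis coord_cont : forall k, cont (fun a => a k).
Hypothesis rad_ge : forall a k, A a -> `|a k| <= rad k.
Hypothesis rad_ge0 : forall k, 0 <= rad k.

(** The common shape of both processes and both limits; index [k] stands for coordinate and lag
    [k + 1]. *)
Definition lin_form (v : nat -> R) (n : nat) (a : nat -> R) : R :=
  series (fun k => a k * v k) n.

Lemma lin_form_cont v n : cont (lin_form v n).
Proof.
rewrite /lin_form /series; elim: n => [|n IH].
  under [X in cont X]funext do rewrite /= big_geq//.
  exact: ld_cont_cst.
under [X in cont X]funext do rewrite /= big_nat_recr//=.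
by apply: ld_contD => //; exact/ld_contM_cst/coord_cont.
Qed.

Lemma lin_form_dist_le v m n a : A a -> (m <= n)%N ->
  `|lin_form v n a - lin_form v m a| <= \sum_(m <= k < n) rad k * `|v k|.
Proof.
move=> Aa mn; rewrite /lin_form sub_series_geq//.
apply: (le_trans (ler_norm_sum _ _ _)); apply: ler_sum => k _.
by rewrite normrM ler_wpM2r// rad_ge.
Qed.

(** The map from coefficients to linear forms is Lipschitz for the uniform distance on [A], with
    constant the sum of the [rad i]. All measurability of [F] along paths stems from this. *)
Lemma functional_lin_form_continuous F m : cont_functional alpha b A F ->
  continuous (fun x : 'rV[R]_m.+1 => F (fun a => \sum_(i < m.+1) a i * x 0 i)).
Proof.
have linE (x : 'rV[R]_m.+1) : (fun a : nat -> R => \sum_(i < m.+1) a i * x 0 i) =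
    lin_form (fun k => if insub k is Some i then x 0 i else 0) m.+1.
  apply/funext => a; rewrite /lin_form /series /= big_mkord.
  by apply: eq_bigr => i _; rewrite valK.
move=> cF; apply/rV_continuousP => x e e0.
have cx y : cont (fun a : nat -> R => \sum_(i < m.+1) a i * (y : 'rV[R]_m.+1) 0 i).
  by rewrite linE; exact: lin_form_cont.
have [r r0 xr] := cF _ (cx x) e e0.
pose C := \sum_(i < m.+1) rad i.
have C0 : 0 <= C by apply: sumr_ge0.
exists (r / (C + 1)); first by rewrite divr_gt0//; lra.
move=> y xy; apply: xr => // a Aa; rewrite -sumrB.
apply: (le_trans (ler_norm_sum _ _ _)).
apply: (@le_trans _ _ (\sum_(i < m.+1) rad i * (r / (C + 1)))).
  apply: ler_sum => i _; rewrite -mulrBr normrM.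
  by apply: ler_pM => //; [exact: rad_ge|exact/ltW/xy].
rewrite -mulr_suml -/C mulrA ler_pdivrMr; last by lra.
by rewrite mulrC ler_pM2l//; lra.
Qed.

Section Measurability.
Context {d : measure_display} {T : measurableType d}.
Variable W : nat -> T -> R.
Hypothesis mW : forall k, measurable_fun setT (W k).

Lemma measurable_functional_lin_form F m : cont_functional alpha b A F ->
  measurable_fun setT (fun w => F (lin_form (W ^~ w) m)).
Proof.
move=> cF; case: m => [|m].
  rewrite (_ : (fun w => _) = fun=> F (fun=> 0)); first exact: measurable_cst.
  apply/funext => w; congr F; apply/funext => a.
  by rewrite /lin_form /series /= big_geq.
have := @measurable_continuous_rV R _ _ m _ (fun i w => W i w)
  (@functional_lin_form_continuous F m cF) (fun i => mW i).
congr measurable_fun; apply/funext => w; congr F; apply/funext => a.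
rewrite /lin_form /series /= big_mkord.
by apply: eq_bigr => i _; rewrite mxE.
Qed.

Lemma bounded_functional_lin_form F m : cont_functional alpha b A F ->
  bounded_on_cont alpha b A F -> bounded_mfun (fun w => F (lin_form (W ^~ w) m)).
Proof.
move=> cF [M FM]; split; first exact: measurable_functional_lin_form.
by exists M => w; exact/FM/lin_form_cont.
Qed.

End Measurability.

Section Limit.
Context {d : measure_display} {T : measurableType d} (Q : probability T R).
Variable W : nat -> T -> R.
Hypothesis mW : forall k, measurable_fun setT (W k).
Hypothesis cvgW : forall w, cvgn (series (fun k => rad k * `|W k w|)).

Definition lin_form_lim (w : T) (a : nat -> R) : R := limn (lin_form (W ^~ w) ^~ a).

Lemma lin_form_cvg w a : A a -> cvgn (lin_form (W ^~ w) ^~ a).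
Proof.
move=> Aa; suff : cvgn (series (fun k => a k * W k w)) by [].
have H : cvgn (series (fun k => `|a k * W k w|)).
  apply: (@series_le_cvg R _ (fun k => rad k * `|W k w|)) => [k|k|k|].
  - exact: normr_ge0.
  - by rewrite mulr_ge0.
  - by rewrite normrM ler_wpM2r// rad_ge.
  - exact: cvgW.
exact: normed_cvg H.
Qed.

Lemma lin_form_lim_dist w (e : R) : 0 < e -> \forall m \near \oo, forall a, A a ->
  `|lin_form_lim w a - lin_form (W ^~ w) m a| <= e.
Proof.
move=> e0; set s := series (fun k => rad k * `|W k w|).
have /cvgrPdist_le /(_ e e0) := @cvgW w; apply: filterS => m sm a Aa.
have ca := @lin_form_cvg w a Aa.
have nds : nondecreasing_seq s.
  by apply: nondecreasing_series => k _ _; rewrite mulr_ge0.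
have H n : (m <= n)%N -> `|lin_form (W ^~ w) n a - lin_form (W ^~ w) m a| <= e.
  move=> mn; apply: (le_trans (lin_form_dist_le _ Aa mn)).
  have -> : \sum_(m <= k < n) rad k * `|W k w| = s n - s m by rewrite sub_series_geq.
  have := nondecreasing_cvgn_le nds (@cvgW w) n.
  by move: sm; rewrite ler_norml => /andP[]; rewrite -/s; lra.
have c1 : (fun n => `|lin_form (W ^~ w) n a - lin_form (W ^~ w) m a|) @ \oo -->
    `|lin_form_lim w a - lin_form (W ^~ w) m a|.
  by apply: cvg_norm; apply: cvgB; [exact: ca|exact: cvg_cst].
rewrite -(cvg_lim _ c1)//; apply: limr_le; first by apply/cvg_ex; eexists; exact: c1.
by exists m.
Qed.

Lemma lin_form_lim_cont w : cont (lin_form_lim w).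
Proof.
apply: ld_cont_uniform_limit => e e0.
have [m _ /(_ m (leqnn m)) H] := lin_form_lim_dist w e0.
by exists (lin_form (W ^~ w) m) => //; exact: lin_form_cont.
Qed.

Lemma functional_lin_form_cvg F w : cont_functional alpha b A F ->
  (fun m => F (lin_form (W ^~ w) m)) @ \oo --> F (lin_form_lim w).
Proof.
move=> cF; apply/cvgrPdist_lt => e e0.
have [r r0 Fr] := cF _ (lin_form_lim_cont w) e e0.
apply: filterS (lin_form_lim_dist w r0) => m H.
by apply: Fr => //; exact: lin_form_cont.
Qed.

Lemma bounded_functional_lim F : cont_functional alpha b A F ->
  bounded_on_cont alpha b A F -> bounded_mfun (fun w => F (lin_form_lim w)).
Proof.
move=> cF [M FM].
apply: (@bounded_mfun_cvg _ _ _ (fun m w => F (lin_form (W ^~ w) m)) _ M).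
- by move=> n; exact: measurable_functional_lin_form.
- by move=> n w; exact/FM/lin_form_cont.
- by move=> w; exact: functional_lin_form_cvg.
Qed.

Lemma expect_functional_lin_form_cvg F : cont_functional alpha b A F ->
  bounded_on_cont alpha b A F ->
  (fun m => \int[Q]_w F (lin_form (W ^~ w) m)) @ \oo --> \int[Q]_w F (lin_form_lim w).
Proof.
move=> cF [M FM]; apply: (@expect_cvg _ _ _ Q _ _ M).
- by move=> n; exact: measurable_functional_lin_form.
- by move=> n w; exact/FM/lin_form_cont.
- by move=> w; exact: functional_lin_form_cvg.
Qed.

Section Convergence.
Context {d1 : measure_display} {T1 : measurableType d1} (P : probability T1 R).
Variables (V : nat -> nat -> T1 -> R) (N : nat -> nat).
Hypothesis mV : forall n k, measurable_fun setT (V n k).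
Hypothesis N_infty : forall m, \forall n \near \oo, (m <= N n)%N.
Hypothesis fdd : forall m, vec_weak_cvg P
  (fun n w => \row_(i < m.+1) V n i w) Q (fun w => \row_(i < m.+1) W i w).
(** Negligibility of the remainder, uniformly over [A], without assuming a mean for it: [D] has
    small mean, and controls the remainder only where [D] lies below a level at most 1. *)
Hypothesis tails : forall e : R, 0 < e -> exists m, \forall n \near \oo,
  exists D : T1 -> R, [/\ bounded_mfun D, forall w, 0 <= D w, \int[P]_w D w <= e &
    forall w x, 0 < x <= 1 -> D w < x -> \sum_(m <= k < N n) rad k * `|V n k w| <= x].

Lemma fdd_functional F m : cont_functional alpha b A F ->
  bounded_on_cont alpha b A F ->
  (fun n => \int[P]_w F (lin_form (fun k => V n k w) m.+1)) @ \oo -->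
  \int[Q]_w F (lin_form (W ^~ w) m.+1).
Proof.
move=> cF bF; have [M FM] := bF.
pose G (x : 'rV[R]_m.+1) := F (fun a => \sum_(i < m.+1) a i * x 0 i).
have GE (v : nat -> R) : G (\row_i v i) = F (lin_form v m.+1).
  rewrite /G; congr F; apply/funext => a; rewrite /lin_form /series /= big_mkord.
  by apply: eq_bigr => i _; rewrite mxE.
have GM x : `|G x| <= M.
  pose v (k : nat) : R := if insub k is Some i then x 0 i else 0.
  have -> : x = \row_i v i by apply/rowP => i; rewrite mxE /v valK.
  by rewrite (GE v); exact/FM/lin_form_cont.
have := fdd (ex_intro _ M GM) (@functional_lin_form_continuous F m cF).
rewrite -/G; under eq_integral do rewrite (GE (W ^~ _)).
rewrite EFin_Rintegral; last exact: bounded_functional_lin_form.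
move=> /fine_cvg; apply: cvg_trans; apply: near_eq_cvg; apply: nearW => n /=.
by apply: congr1; apply: eq_integral => w _; rewrite (GE (fun k => V n k w)).
Qed.

(** Interchange of the limits in [m] and [n]: [m] is fixed first, beyond what [tails] and the
    convergence of the limit forms require, then [n] grows. The four quarters of [e] go to the
    modulus of [F], the event where [D] is large, the finite-dimensional limit and the truncation of
    the limit form. *)
Lemma weak_cvg_ucont F : ucont_functional alpha b A F ->
  bounded_on_cont alpha b A F ->
  (fun n => \int[P]_w F (lin_form (fun k => V n k w) (N n))) @ \oo -->
  \int[Q]_w F (lin_form_lim w).
Proof.
move=> uF bF; have cF := ucont_functional_cont uF; have [M FM] := bF.
have M0 : 0 <= M by apply: le_trans (FM (fun=> 0) _); [exact: normr_ge0|exact: ld_cont_cst].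
apply/cvgrPdist_le => e e0.
have e4 : 0 < e / 4 by lra.
have [r r0 Fr] := uF _ e4.
pose x := Num.min r 1.
have x01 : 0 < x <= 1 by rewrite lt_min r0 ltr01 ge_min lexx orbT.
have [x0 x1] := andP x01.
(* Where [D] is at least [x], the trivial bound [2 M] is at most [K * D]. The mean of [D] is then
   requested below a multiple of [1 / (K + 1)], which makes sense even for [K = 0]. *)
pose K := 2 * M / x.
have K0 : 0 <= K by rewrite divr_ge0 ?mulr_ge0// ltW.
have [m0 Hm0] := tails (divr_gt0 e4 (ltr_wpDl K0 ltr01)).
have /cvgrPdist_le /(_ _ e4) [m1 _ Hm1] := expect_functional_lin_form_cvg cF bF.
pose m := (m0 + m1)%N.
have m1m : (m1 <= m.+1)%N by rewrite /m; lia.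
have {}Hm1 := Hm1 m.+1 m1m.
have /cvgrPdist_le /(_ _ e4) Hfdd := @fdd_functional F m cF bF.
near=> n.
have [D [bD D0 ED Dx]] : exists D : T1 -> R, [/\ bounded_mfun D, forall w, 0 <= D w,
    \int[P]_w D w <= e / 4 / (K + 1) &
    forall w x, 0 < x <= 1 -> D w < x -> \sum_(m0 <= k < N n) rad k * `|V n k w| <= x].
  by near: n.
have mn : (m.+1 <= N n)%N by near: n; exact: N_infty.
have Hn : `|\int[Q]_w F (lin_form (W ^~ w) m.+1) -
    \int[P]_w F (lin_form (fun k => V n k w) m.+1)| <= e / 4 by near: n.
have bV k : bounded_mfun (fun w => F (lin_form (fun k => V n k w) k)).
  exact: (bounded_functional_lin_form (mV n)).
have cmp w : `|F (lin_form (fun k => V n k w) (N n)) -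
    F (lin_form (fun k => V n k w) m.+1)| <= e / 4 + K * D w.
  have [Dw|Dw] := ltP (D w) x.
    have : 0 <= K * D w by exact: mulr_ge0.
    suff : `|F (lin_form (fun k => V n k w) (N n)) -
      F (lin_form (fun k => V n k w) m.+1)| < e / 4 by lra.
    apply: Fr; [exact: lin_form_cont|exact: lin_form_cont|] => a Aa.
    apply: (le_trans (lin_form_dist_le _ Aa mn)).
    apply: (@le_trans _ _ x); last by rewrite ge_min lexx.
    apply: le_trans (Dx w x x01 Dw).
    have m0m : (m0 <= m.+1)%N by rewrite /m; lia.
    rewrite [leRHS](big_cat_nat (n := m.+1))//= lerDr.
    by apply: sumr_ge0 => k _; rewrite mulr_ge0.
  have : 2 * M <= K * D w.
    rewrite /K mulrAC ler_pdivlMr//; apply: ler_wpM2l => //; exact: mulr_ge0.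
  have := FM _ (lin_form_cont (fun k => V n k w) (N n)).
  have := FM _ (lin_form_cont (fun k => V n k w) m.+1).
  have := ler_normB (F (lin_form (fun k => V n k w) (N n)))
    (F (lin_form (fun k => V n k w) m.+1)).
  lra.
have := expect_dist_le P (bV _) (bV _) bD cmp.
have KD : K * \int[P]_w D w <= e / 4.
  apply: (@le_trans _ _ (K * (e / 4 / (K + 1)))); first exact: ler_wpM2l.
  rewrite mulrA ler_pdivrMr; last by lra.
  by rewrite mulrC ler_pM2l//; lra.
move: Hn Hm1; rewrite !ler_norml => /andP[? ?] /andP[? ?] /andP[? ?].
by apply/andP; split; lra.
Unshelve. all: by end_near. Qed.

(** The level [L] of the minorant is fixed by dominated convergence on the limit side before [n]
    grows, so no uniformity in [L] is needed; on the other side the minorant is simply below [F]. *)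
Lemma weak_cvg_lower F : cont_functional alpha b A F -> bounded_on_cont alpha b A F ->
  forall e : R, 0 < e -> \forall n \near \oo, \int[Q]_w F (lin_form_lim w) - e <=
    \int[P]_w F (lin_form (fun k => V n k w) (N n)).
Proof.
move=> cF bF e e0; have [M FM] := bF; have e2 : 0 < e / 2 by lra.
pose FL (L : nat) := lipschitz_minorant alpha b A L%:R F.
have L0 (L : nat) : 0 <= L%:R :> R by [].
have uFL L : ucont_functional alpha b A (FL L) := lipschitz_minorant_ucont FM (L0 L).
have cFL L := ucont_functional_cont (uFL L).
have FLM L f : cont f -> `|FL L f| <= M by exact: (lipschitz_minorant_bound FM (L0 L)).
have bFL L : bounded_on_cont alpha b A (FL L) by exists M => f; exact: FLM.
have cvL : (fun L => \int[Q]_w FL L (lin_form_lim w)) @ \oo --> \int[Q]_w F (lin_form_lim w).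
  apply: (@expect_cvg _ _ _ Q (fun L w => FL L (lin_form_lim w)) _ M).
  - by move=> L; have [] := bounded_functional_lim (cFL L) (bFL L).
  - by move=> L w; exact/FLM/lin_form_lim_cont.
  - by move=> w; exact: (lipschitz_minorant_cvg FM cF (lin_form_lim_cont w)).
have /cvgrPdist_le /(_ _ e2) [L _ /(_ L (leqnn L)) HL] := cvL.
have /cvgrPdist_le /(_ _ e2) := weak_cvg_ucont (uFL L) (bFL L).
apply: filterS => n Hn.
have : \int[P]_w FL L (lin_form (fun k => V n k w) (N n)) <=
    \int[P]_w F (lin_form (fun k => V n k w) (N n)).
  apply: le_expect.
  - exact: (bounded_functional_lin_form (mV n)).
  - exact: (bounded_functional_lin_form (mV n)).
  - by move=> w; apply: (lipschitz_minorant_le FM (L0 L)); exact: lin_form_cont.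
by move: HL Hn; rewrite !ler_norml => /andP[? ?] /andP[? ?]; lra.
Qed.

Lemma weak_cvg_functional F : cont_functional alpha b A F ->
  bounded_on_cont alpha b A F ->
  (fun n => \int[P]_w F (lin_form (fun k => V n k w) (N n))) @ \oo -->
  \int[Q]_w F (lin_form_lim w).
Proof.
move=> cF bF; have [M FM] := bF; apply/cvgrPdist_le => e e0.
have cNF : cont_functional alpha b A (fun f => -1 * F f).
  move=> f cf e' e'0; have [r r0 fr] := cF f cf e' e'0; exists r => // g cg fg.
  by rewrite -mulrBr normrM normrN1 mul1r fr.
have bNF : bounded_on_cont alpha b A (fun f => -1 * F f).
  by exists M => f cf; rewrite normrM normrN1 mul1r FM.
apply: filterS2 (weak_cvg_lower cF bF e0) (weak_cvg_lower cNF bNF e0) => n.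
have bl := bounded_functional_lim cF bF.
have bn := bounded_functional_lin_form (mV n) (N n) cF bF.
rewrite (expectZ _ _ bl) (expectZ _ _ bn).
by move=> h1 h2; rewrite ler_norml; apply/andP; split; lra.
Qed.

End Convergence.
End Limit.
End WeakConvergence.

(** * Summable weights *)

Section Weights.
Context {R : realType}.
Variables alpha b : R.
Hypothesis alpha01 : 0 < alpha < 1.
Hypothesis b_gt0 : 0 < b.
Hypothesis h_concave : forall x y t : R, 0 < x -> 0 < y -> 0 <= t <= 1 ->
  t * hfun alpha b x + (1 - t) * hfun alpha b y <=
  hfun alpha b (t * x + (1 - t) * y).
Local Notation h := (hfun alpha b).

Let ge0 := @hfun_ge0 R alpha b alpha01 b_gt0 h_concave.

(** Because [b > 1], [h(x) >= |x|^alpha ln b] with a positive logarithm. This keeps each set of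
    [|a k|] bounded, so that its supremum is meaningful. *)
Lemma hfun_le_bound (x H : R) : h x <= H -> `|x| <= (H / ln b) `^ alpha^-1.
Proof.
move=> hx; have b1 := hfun_base_gt1 alpha01 b_gt0 h_concave.
have lb0 : 0 < ln b by exact: ln_gt0.
have [a0 a1] := andP alpha01.
have H0 : 0 <= H by exact: le_trans (ge0 x) hx.
have [->|x0] := eqVneq x 0; first by rewrite normr0 powR_ge0.
have xn : 0 < `|x| by rewrite normr_gt0.
have : `|x| `^ alpha <= H / ln b.
  rewrite ler_pdivlMr//; apply: le_trans hx.
  rewrite -hfun_norm hfun_pos//; apply: ler_wpM2l; first exact: powR_ge0.
  by rewrite ler_ln ?posrE ?addr_gt0 ?invr_gt0// lerDl invr_ge0 ltW.
move=> Hx; have -> : `|x| = (`|x| `^ alpha) `^ alpha^-1.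
  by rewrite -powRrM divff ?gt_eqF// powRr1.
by rewrite ge0_ler_powR ?nnegrE ?powR_ge0 ?invr_ge0 ?(ltW a0)// divr_ge0// ltW.
Qed.

(** One factor 2 is [2^alpha <= 2]; the other is [1 - ln x <= - 2 ln x], valid as soon as
    [x <= 1/e]. The argument is doubled because [h] will only be controlled at half of the
    supremum. *)
Lemma log_weight_le (x : R) : 0 <= x -> x <= expR (- 1) ->
  2 * x <= 1 /\ (2 * x) `^ alpha * (1 - ln (2 * x)) <= 4 * h x.
Proof.
have [a0 a1] := andP alpha01.
move=> x0 x1; have e2 : 2 <= expR 1 :> R by have := @expR_ge1Dx R 1; lra.
have x2 : 2 * x <= 1.
  apply: (@le_trans _ _ (expR 1 * expR (- 1))); last by rewrite expRxMexpNx_1.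
  by rewrite ler_pM.
split => //; move: x0; rewrite le_eqVlt => /predU1P[<-|x0].
  by rewrite mulr0 powR0 ?gt_eqF// mul0r hfun0 mulr0.
rewrite hfun_pos// powRM ?(ltW x0)//.
have lx : 1 <= - ln x.
  have : ln x <= ln (expR (- 1)) by rewrite ler_ln ?posrE ?expR_gt0.
  by rewrite expRK; lra.
have lb : - ln x <= ln (b + x^-1).
  by rewrite -lnV ?posrE// ler_ln ?posrE ?addr_gt0 ?invr_gt0// lerDr ltW.
have l2 : 0 <= ln 2 :> R by apply: ln_ge0; rewrite ler1n.
have l2x : ln (2 * x) <= 0 by exact: ln_le0.
have p2 : 2 `^ alpha <= 2 :> R by apply: ler1_powR; [rewrite ler1n|exact: ltW].
have p20 : 0 <= 2 `^ alpha * x `^ alpha :> R by rewrite mulr_ge0 ?powR_ge0.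
have -> : 4 * (x `^ alpha * ln (b + x^-1)) = 2 * x `^ alpha * (2 * ln (b + x^-1)) by ring.
apply: ler_pM => //; first by lra.
  by apply: ler_wpM2r => //; exact: powR_ge0.
rewrite lnM ?posrE//; move: (ln (b + x^-1)) lb => l lb; lra.
Qed.

(** With [rad k] the supremum of [|a k|], some [a] in [A] has [|a k| > rad k / 2], so
    [h (rad k / 2)] is below the supremum of [h (a k)], without any continuity of [h]. Those suprema
    tend to 0, so [rad k / 2] drops below [1/e] from some [k0] on. *)
Lemma summable_weights (A : set (nat -> R)) :
  (\sum_(0 <= k <oo) ereal_sup [set (h (a k))%:E | a in A] < +oo)%E ->
  exists (rad u : nat -> R) (k0 : nat),
    [/\ forall a k, A a -> `|a k| <= rad k, forall k, 0 <= rad k,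
        forall k, 0 <= u k, cvgn (series u) &
        forall k, (k0 <= k)%N -> rad k <= 1 /\ rad k `^ alpha * (1 - ln (rad k)) <= u k].
Proof.
have [a0 a1] := andP alpha01.
(* For empty [A] every supremum is [-oo], so this case is settled by zero weights. *)
have [->|/set0P[c Ac]] := eqVneq A set0.
  move=> _; exists (fun=> 0), (fun=> 0), 0%N; split => //.
    apply/cvg_ex; exists 0; rewrite (_ : series _ = cst 0); first exact: cvg_cst.
    by apply/funext => n; rewrite /series /= big1.
  by move=> k _; rewrite powR0 ?gt_eqF// mul0r.
pose S k := ereal_sup [set (h (a k))%:E | a in A].
rewrite -/(S _) => Soo.
have S0 k : (0 <= S k)%E.
  apply: (@le_trans _ _ (h (c k))%:E); first by rewrite lee_fin; exact: ge0.
  by apply: ereal_sup_ubound; exists c.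
have Spart n : (\sum_(0 <= k < n) S k <= \sum_(0 <= k <oo) S k)%E.
  by apply: nneseries_lim_ge => k _ _; exact: S0.
have Sfin k : S k \is a fin_num.
  rewrite ge0_fin_numE ?S0//; apply: le_lt_trans Soo.
  apply: le_trans (Spart k.+1); rewrite big_nat_recr//= leeDr//.
  by apply: sume_ge0 => i _; exact: S0.
pose H k := fine (S k).
have HE k : S k = (H k)%:E by rewrite fineK.
have H0 k : 0 <= H k by exact/fine_ge0/S0.
have cvgH : cvgn (series H).
  apply: nondecreasing_is_cvgn; first exact: nondecreasing_series.
  exists (fine (\sum_(0 <= k <oo) S k)) => _ [n _ <-]; rewrite -lee_fin fineK.
    rewrite /series /= -sumEFin; apply: le_trans (Spart n).
    by rewrite le_eqVlt; apply/orP; left; apply/eqP; apply: eq_bigr => k _; rewrite HE.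
  rewrite ge0_fin_numE//; apply: nneseries_ge0 => k _ _; exact: S0.
have hH a k : A a -> h (a k) <= H k.
  by move=> Aa; rewrite -lee_fin -HE; apply: ereal_sup_ubound; exists a.
pose B k := [set `|a k| | a in A].
have hsB k : has_sup (B k).
  split; first by exists `|c k|, c.
  by exists ((H k / ln b) `^ alpha^-1) => _ [a Aa <-]; exact/hfun_le_bound/hH.
pose rad k := sup (B k).
have radge a k : A a -> `|a k| <= rad k.
  by move=> Aa; apply: ub_le_sup; [exact: (hsB k).2|exists a].
have rad0 k : 0 <= rad k by exact: le_trans (radge c k Ac).
have hrad k : h (rad k / 2) <= H k.
  have [r0|r0] := eqVneq (rad k) 0; first by rewrite r0 mul0r hfun0.
  have rpos : 0 < rad k by rewrite lt0r r0 rad0.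
  have [_ [a Aa <-] ra] := sup_adherent (divr_gt0 rpos (ltr0n _ 2)) (hsB k).
  apply: le_trans (hH a k Aa); apply: (ler_hfun alpha01 b_gt0 h_concave).
  rewrite ger0_norm ?divr_ge0//; move: ra; rewrite -/(rad k); lra.
have : 0 < h (expR (- 1)).
  by apply: hfun_gt0 => //; rewrite gt_eqF// expR_gt0.
have /cvgrPdist_lt H_cvg0 := cvg_series_cvg_0 cvgH.
move=> /H_cvg0 [k0 _ Hk0].
exists rad, (fun k => 4 * H k), k0; split => //.
- by move=> k; rewrite mulr_ge0.
- exact: is_cvg_seriesZ.
move=> k /Hk0; rewrite sub0r normrN ger0_norm// => Hk.
have := hfun_lt alpha01 b_gt0 h_concave (le_lt_trans (hrad k) Hk).
rewrite ger0_norm ?divr_ge0// ger0_norm ?expR_ge0// => /ltW xe.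
have [] := log_weight_le (divr_ge0 (rad0 k) (ler0n _ 2)) xe.
have -> : 2 * (rad k / 2) = rad k by field.
move=> r1 r2; split => //; apply: (le_trans r2).
by rewrite ler_pM2l.
Qed.

End Weights.

Lemma cvgn_series_bounded (R : realType) (z : nat -> R) (C : R) : (forall k, 0 <= z k) ->
  (forall n, series z n <= C) -> cvgn (series z).
Proof.
move=> z0 zC; apply: nondecreasing_is_cvgn; first exact: nondecreasing_series.
by exists C => _ [n _ <-].
Qed.

(** Summable truncated terms tend to 0, hence are eventually below 1, where the truncation is
    inactive. *)
Lemma cvgn_series_min1 (R : realType) (z : nat -> R) (C : R) : (forall k, 0 <= z k) ->
  (forall n, \sum_(0 <= k < n) Num.min 1 (z k) <= C) -> cvgn (series z).
Proof.
move=> z0 zC; pose f k := Num.min 1 (z k).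
have f0 k : 0 <= f k by rewrite le_min ler01 z0.
have cf : cvgn (series f) by exact: (cvgn_series_bounded f0 zC).
have /cvgrPdist_lt/(_ 1 ltr01) [m _ Hm] := cvg_series_cvg_0 cf.
have fz k : (m <= k)%N -> z k = f k.
  move=> /Hm; rewrite sub0r normrN ger0_norm// /f.
  by rewrite minElt; case: ifP => // _; rewrite ltxx.
apply: (@cvgn_series_bounded _ _ (series z m + C)) => // n; rewrite /series /=.
have sf0 : 0 <= \sum_(0 <= k < m) f k by apply: sumr_ge0.
have C0 : 0 <= C by have := zC 0%N; rewrite big_geq.
have [nm|mn] := leqP n m.
  rewrite [X in _ <= X + C](big_cat_nat (n := n))//=.
  have : 0 <= \sum_(n <= k < m) z k by apply: sumr_ge0.
  lra.
rewrite (big_cat_nat (n := m)) ?(ltnW mn)//= lerD2l.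
have -> : \sum_(m <= k < n) z k = \sum_(m <= k < n) f k.
  by apply: eq_big_nat => k /andP[mk _]; exact: fz.
have := zC n; rewrite (big_cat_nat (n := m)) ?(ltnW mn)//=.
by move: sf0; rewrite /f; lra.
Qed.

Section AlmostSureSummability.
Context {R : realType} {d : measure_display} {T : measurableType d}.
Variable P : probability T R.

(** The sum of the truncations has finite mean by monotone convergence, each of the first [k0] terms
    costing at most 1, so it is finite off a null set; the truncation is then removed pathwise. *)
Lemma ae_summable (Z : nat -> T -> R) (u : nat -> R) (k0 : nat) :
  (forall k, measurable_fun setT (Z k)) -> (forall k w, 0 <= Z k w) ->
  (forall k, 0 <= u k) -> cvgn (series u) ->
  (forall k, (k0 <= k)%N -> \int[P]_w Num.min 1 (Z k w) <= u k) ->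
  exists N, [/\ measurable N, P N = 0%E & forall w, ~ N w -> cvgn (series (Z ^~ w))].
Proof.
move=> mZ Z0 u0 cu Zu.
pose f k w := Num.min 1 (Z k w).
have f0 k w : 0 <= f k w by rewrite le_min ler01 Z0.
have mf k : measurable_fun setT (f k) by exact: measurable_minr.
have bf k : bounded_mfun (f k).
  by split => //; exists 1 => w; rewrite ger0_norm// ge_min lexx.
have mfE k : measurable_fun setT (fun w => (f k w)%:E) by exact/measurable_EFinP.
have f0E k w : (0 <= (f k w)%:E)%E by rewrite lee_fin.
pose g w := (\sum_(0 <= k <oo) (f k w)%:E)%E.
have mg : measurable_fun setT g by apply: ge0_emeasurable_sum => // k w _ _.
have ig : (\int[P]_w g w <= (k0%:R + limn (series u))%:E)%E.
  rewrite /g integral_nneseries//; apply: lime_le.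
    by apply: is_cvg_nneseries => k _ _; exact: integral_ge0.
  apply: nearW => n; under eq_bigr do rewrite EFin_Rintegral//.
  rewrite sumEFin lee_fin.
  apply: (@le_trans _ _ (\sum_(0 <= k < n) ((k < k0)%N%:R + u k))).
    apply: ler_sum => k _; have [kk|kk] := ltnP k k0; last by rewrite add0r Zu.
    apply: (@le_trans _ _ 1); last by rewrite lerDl.
    rewrite -[leRHS](expect_cst P); apply: le_expect => //; first exact: bounded_mfun_cst.
    by move=> w; rewrite /f ge_min lexx.
  rewrite big_split /=; apply: lerD.
    rewrite -natr_sum ler_nat -(big_mkcond (fun k => k < k0)%N (fun=> 1%N)) /=.
    rewrite sum1_count; have -> : k0 = size (iota 0 k0) by rewrite size_iota.
    rewrite -size_filter; apply: uniq_leq_size; first by rewrite filter_uniq// iota_uniq.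
    by move=> k; rewrite mem_filter !mem_iota size_iota => /andP[].
  by apply: nondecreasing_cvgn_le => //; exact: nondecreasing_series.
have g0 w : (0 <= g w)%E by exact: nneseries_ge0.
have ing : P.-integrable setT g.
  apply/integrableP; split => //; under eq_integral do rewrite gee0_abs//.
  exact: le_lt_trans ig (ltry _).
have [N [mN PN gN]] := integrable_ae measurableT ing.
exists N; split => // w Nw.
have gfin : g w \is a fin_num.
  by apply: contrapT => h; apply: Nw; apply: gN => /(_ I).
apply: (@cvgn_series_min1 _ _ (fine (g w))) => // n.
rewrite -lee_fin fineK// -sumEFin; apply: nneseries_lim_ge => k _ _; exact: f0E.
Qed.

End AlmostSureSummability.

(** * Passage to the ratio *)

Section RatioLimit.
Context {R : realType}.

Lemma continuous_rV_map (p q : nat) (f : 'rV[R]_q.+1 -> R)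
    (c : 'I_q.+1 -> 'rV[R]_p.+1 -> R) :
  continuous f -> (forall i, continuous (c i)) -> continuous (fun x => f (\row_i c i x)).
Proof.
move=> /rV_continuousP cf cc; apply/rV_continuousP => x e e0.
have [r r0 fr] := cf (\row_i c i x) e e0.
have ex i : exists s : R, 0 < s /\
    forall y : 'rV[R]_p.+1, (forall j, `|x 0 j - y 0 j| < s) -> `|c i x - c i y| < r.
  by have /rV_continuousP /(_ x r r0) [s s0 Hs] := cc i; exists s.
have [s Hs] := choice ex.
exists (\big[Num.min/1]_i s i).
  by elim/big_ind: _ => // [u v u0 v0|i _]; [rewrite lt_min u0|case: (Hs i)].
move=> y xy; apply: fr => i; rewrite !mxE; apply: (Hs i).2 => j.
by apply: (lt_le_trans (xy j)); exact: bigmin_le.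
Qed.

(* bump dominates the indicator of [-delta, delta], where v^-1 and its continuous
   replacement cutoff_inv may differ. *)
Definition bump (delta v : R) : R := 2 * delta ^+ 2 / (delta ^+ 2 + v ^+ 2).

Definition cutoff_inv (delta v : R) : R := v / Num.max (v ^+ 2) (delta ^+ 2).

Lemma bump_den_gt0 (delta v : R) : 0 < delta -> 0 < delta ^+ 2 + v ^+ 2.
Proof. by move=> d0; rewrite ltr_pwDl ?exprn_gt0// sqr_ge0. Qed.

Lemma bump_ge0 (delta v : R) : 0 < delta -> 0 <= bump delta v.
Proof. by move=> d0; rewrite divr_ge0 ?mulr_ge0 ?sqr_ge0// ltW// bump_den_gt0. Qed.

Lemma bump_le2 (delta v : R) : 0 < delta -> bump delta v <= 2.
Proof.
move=> d0; rewrite ler_pdivrMr ?bump_den_gt0// ler_pM2l// lerDl; exact: sqr_ge0.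
Qed.

Lemma bump_ge1 (delta v : R) : 0 < delta -> `|v| <= delta -> 1 <= bump delta v.
Proof.
move=> d0 vd; rewrite ler_pdivlMr ?bump_den_gt0// mul1r.
suff : v ^+ 2 <= delta ^+ 2 by lra.
by rewrite -(ger0_norm (sqr_ge0 v)) normrX ler_pXn2r ?nnegrE// ltW.
Qed.

Lemma continuous_bump (delta : R) : 0 < delta -> continuous (bump delta).
Proof.
move=> d0 v; apply: cvgM; first exact: cvg_cst.
apply: cvgV; first by rewrite gt_eqF// bump_den_gt0.
by apply: cvgD; [exact: cvg_cst|exact: exprn_continuous].
Qed.

Lemma continuous_cutoff_inv (delta : R) : 0 < delta -> continuous (cutoff_inv delta).
Proof.
move=> d0 v; apply: cvgM; first exact: cvg_id.
apply: cvgV; first by rewrite gt_eqF// lt_max orbC exprn_gt0.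
have cm := @continuous_max R (Topological.clone _ R) (fun v => v ^+ 2) (fun=> delta ^+ 2) v.
by apply: cm; [exact: exprn_continuous|exact: cvg_cst].
Qed.

Lemma cutoff_invE (delta v : R) : 0 < delta -> delta <= `|v| -> cutoff_inv delta v = v^-1.
Proof.
move=> d0 dv; have v0 : v != 0 by rewrite -normr_gt0 (lt_le_trans d0).
rewrite /cutoff_inv max_l; first by rewrite expr2 invfM mulrA divff// mul1r.
by rewrite -(ger0_norm (sqr_ge0 v)) normrX ler_pXn2r ?nnegrE// ltW.
Qed.

(** A pointwise limit of continuous cut-off inverses; at a zero of [X] both sides vanish by the
    convention that the inverse of 0 is 0. *)
Lemma measurable_inv (d : measure_display) (T : measurableType d) (X : T -> R) :
  measurable_fun setT X -> measurable_fun setT (fun w => (X w)^-1).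
Proof.
move=> mX; apply: (@measurable_fun_cvg _ _ _ _
  (fun n w => cutoff_inv n.+1%:R^-1 (X w))) => [n|w _].
  apply: measurableT_comp => //; apply: continuous_measurable_fun.
  by apply: continuous_cutoff_inv; rewrite invr_gt0.
have [X0|X0] := eqVneq (X w) 0.
  rewrite X0 invr0 (_ : (fun n => _) = cst 0); first exact: cvg_cst.
  by apply/funext => n; rewrite /cutoff_inv mul0r.
apply: cvg_near_cst; exists (Num.truncn `|X w|^-1) => // n /= nX.
apply: cutoff_invE; first by rewrite invr_gt0.
rewrite -[leRHS]invrK lef_pV2 ?posrE ?invr_gt0 ?normr_gt0//.
by apply/ltW/(lt_le_trans (truncnS_gt _)); rewrite ler_nat ltnS.
Qed.

Section Vectors.
Context {d1 : measure_display} {T1 : measurableType d1} (P : probability T1 R).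
Context {d2 : measure_display} {T2 : measurableType d2} (Q : probability T2 R).

Lemma bounded_mfun_rV (d : measure_display) (T : measurableType d) (m : nat)
    (f : 'rV[R]_m.+1 -> R) (V : nat -> T -> R) :
  continuous f -> (exists M, forall x, `|f x| <= M) ->
  (forall k, measurable_fun setT (V k)) ->
  bounded_mfun (fun w => f (\row_(i < m.+1) V i w)).
Proof.
move=> cf [M fM] mV; split; last by exists M => w.
exact: (measurable_continuous_rV cf (fun i : 'I_m.+1 => mV i)).
Qed.

Variables (V : nat -> nat -> T1 -> R) (W : nat -> T2 -> R).
Hypothesis mV : forall n k, measurable_fun setT (V n k).
Hypothesis mW : forall k, measurable_fun setT (W k).

Lemma vec_weak_cvg_expect (m : nat) :
  vec_weak_cvg P (fun n w => \row_(i < m.+1) V n i w) Q (fun w => \row_(i < m.+1) W i w) <->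
  forall f : 'rV[R]_m.+1 -> R, (exists M, forall x, `|f x| <= M) -> continuous f ->
    (fun n => \int[P]_w f (\row_(i < m.+1) V n i w)) @ \oo -->
    \int[Q]_w f (\row_(i < m.+1) W i w).
Proof.
have EV f n : continuous f -> (exists M, forall x, `|f x| <= M) ->
    (\int[P]_w (f (\row_(i < m.+1) V n i w))%:E)%E =
    (\int[P]_w f (\row_(i < m.+1) V n i w))%:E.
  by move=> cf bf; rewrite EFin_Rintegral//; exact: (bounded_mfun_rV cf bf (mV n)).
have EW f : continuous f -> (exists M, forall x, `|f x| <= M) ->
    (\int[Q]_w (f (\row_(i < m.+1) W i w))%:E)%E =
    (\int[Q]_w f (\row_(i < m.+1) W i w))%:E.
  by move=> cf bf; rewrite EFin_Rintegral//; exact: (bounded_mfun_rV cf bf mW).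
split=> H f bf cf; have {H} := H f bf cf; first by rewrite EW// => /fine_cvg.
move=> H; rewrite EW//; apply: cvg_EFin; last exact: H.
by apply: nearW => n; rewrite EV.
Qed.

Hypothesis fdd : forall m, vec_weak_cvg P (fun n w => \row_(i < m.+1) V n i w) Q
  (fun w => \row_(i < m.+1) W i w).

Lemma fdd_map (m q : nat) (c : 'I_q.+1 -> 'rV[R]_m.+1 -> R) (f : 'rV[R]_q.+1 -> R) :
  (exists M, forall x, `|f x| <= M) -> continuous f -> (forall i, continuous (c i)) ->
  (fun n => \int[P]_w f (\row_i c i (\row_(j < m.+1) V n j w))) @ \oo -->
  \int[Q]_w f (\row_i c i (\row_(j < m.+1) W j w)).
Proof.
move=> [M fM] cf cc.
apply: ((vec_weak_cvg_expect m).1 (@fdd m) (fun x => f (\row_i c i x))).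
  by exists M.
exact: continuous_rV_map.
Qed.

Lemma expect_bump_cvg (delta : R) : 0 < delta ->
  (fun n => \int[P]_w bump delta (V n 0%N w)) @ \oo --> \int[Q]_w bump delta (W 0%N w).
Proof.
move=> d0.
have bb : exists M, forall x : 'rV[R]_1, `|bump delta (x 0 0)| <= M.
  by exists 2 => x; rewrite ger0_norm ?bump_ge0// bump_le2.
have cb : continuous (fun x : 'rV[R]_1 => bump delta (x 0 0)).
  move=> x; apply: continuous_comp; first exact: coord_continuous.
  exact: continuous_bump.
have := (vec_weak_cvg_expect 0).1 (@fdd 0) _ bb cb.
have E1 n : \int[P]_w bump delta ((\row_(i < 1) V n i w) 0 0) =
    \int[P]_w bump delta (V n 0%N w) by apply: eq_Rintegral => w _; rewrite mxE.
have E2 : \int[Q]_w bump delta ((\row_(i < 1) W i w) 0 0) =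
    \int[Q]_w bump delta (W 0%N w) by apply: eq_Rintegral => w _; rewrite mxE.
by rewrite E2; under eq_fun do rewrite E1.
Qed.

Lemma bounded_mfun_bump (d : measure_display) (T : measurableType d) (X : T -> R) (delta : R) :
  0 < delta -> measurable_fun setT X -> bounded_mfun (fun w => bump delta (X w)).
Proof.
move=> d0 mX; split; last by exists 2 => x; rewrite ger0_norm ?bump_ge0// bump_le2.
apply: measurableT_comp => //; apply: continuous_measurable_fun.
exact: continuous_bump.
Qed.

Hypothesis W0 : Q [set w | W 0%N w = 0] = 0%E.

(** As [delta] tends to 0, the bump decreases to twice the indicator of a null event. Once [delta]
    is fixed, the bump is a bounded continuous function, so its small mean passes to [V n] for large
    [n]. *)
Lemma expect_bump_small (e : R) : 0 < e -> exists2 delta : R, 0 < delta &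
  \int[Q]_w bump delta (W 0%N w) <= e /\
  \forall n \near \oo, \int[P]_w bump delta (V n 0%N w) <= e.
Proof.
move=> e0; pose A := [set w | W 0%N w = 0].
have mA : measurable A by rewrite -[A]setTI; exact: mW (measurable_set1 0).
have inv0 (n : nat) : 0 < n.+1%:R^-1 :> R by rewrite invr_gt0.
have lim : (fun n => \int[Q]_w bump n.+1%:R^-1 (W 0%N w)) @ \oo --> \int[Q]_w (2 * \1_A w).
  apply: (@expect_cvg _ _ _ Q (fun n w => bump n.+1%:R^-1 (W 0%N w)) _ 2).
  - by move=> n; have [] := bounded_mfun_bump (inv0 n) (mW 0%N).
  - by move=> n w; rewrite ger0_norm ?bump_ge0// bump_le2.
  - move=> w; rewrite indicE; case: (boolP (w \in A)) => [|wA].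
      rewrite inE /A /= => ->; rewrite mulr1.
      rewrite (_ : (fun n => _) = cst 2); first exact: cvg_cst.
      apply/funext => n; have dn : (n.+1%:R^-1 : R) ^+ 2 != 0.
        by rewrite expf_neq0// gt_eqF.
      by rewrite /bump expr0n /= addr0 -mulrA divff ?mulr1.
    rewrite mulr0; have w0 : W 0%N w != 0.
      by apply: contra wA => /eqP h; rewrite inE.
    have c0 : (fun n : nat => n.+1%:R^-1 : R) @ \oo --> 0 by exact: cvg_harmonic.
    have cs : (fun n : nat => (n.+1%:R^-1 : R) ^+ 2) @ \oo --> (0 : R).
      rewrite -[X in _ --> X](mulr0 (0 : R)); under eq_fun do rewrite expr2.
      exact: (cvgM c0 c0).
    rewrite /bump [X in _ --> X](_ : 0 = 2 * 0 / (0 + W 0%N w ^+ 2)); last first.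
      by rewrite mulr0 mul0r.
    apply: cvgM; first by apply: cvgM => //; exact: cvg_cst.
    apply: cvgV; first by rewrite add0r sqrf_eq0.
    by apply: cvgD => //; exact: cvg_cst.
rewrite expectZ in lim; last exact: bounded_mfun_indic.
rewrite expect_indic// W0 /= mulr0 in lim.
have e2 : 0 < e / 2 by lra.
have /cvgrPdist_le /(_ _ e2) [n _ /(_ n (leqnn n)) Hn] := lim.
exists n.+1%:R^-1; first exact: inv0.
move: Hn; rewrite sub0r normrN => /(le_trans (ler_norm _)) Hn; split; first by lra.
have /cvgrPdist_le /(_ _ e2) := expect_bump_cvg (inv0 n).
by apply: filterS => k; rewrite ler_norml => /andP[]; lra.
Qed.

Lemma fdd_shift (m : nat) : vec_weak_cvg P (fun n w => \row_(i < m.+1) V n i.+1 w) Q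
  (fun w => \row_(i < m.+1) W i.+1 w).
Proof.
move=> f [M fM] cf.
have bf : exists M, forall x : 'rV[R]_m.+2, `|f (\row_i x 0 (lift ord0 i))| <= M.
  by exists M.
have cf' : continuous (fun x : 'rV[R]_m.+2 => f (\row_i x 0 (lift ord0 i))).
  by apply: continuous_rV_map => // i; exact: coord_continuous.
have := @fdd m.+1 _ bf cf'.
have E1 n w : f (\row_i (\row_(j < m.+2) V n j w) 0 (lift ord0 i)) =
    f (\row_(i < m.+1) V n i.+1 w).
  by congr f; apply/rowP => i; rewrite !mxE.
have E2 w : f (\row_i (\row_(j < m.+2) W j w) 0 (lift ord0 i)) =
    f (\row_(i < m.+1) W i.+1 w).
  by congr f; apply/rowP => i; rewrite !mxE.
under eq_integral do rewrite E2.
by under eq_fun do under eq_integral do rewrite E1.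
Qed.

(** Continuous mapping for a map that is discontinuous at denominator 0: the inverse is replaced by
    [cutoff_inv], and the error is at most [2 M] times the bump of the denominator, whose mean is
    small on both sides. *)
Lemma fdd_ratio (m : nat) :
  vec_weak_cvg P (fun n w => \row_(i < m.+1) (V n i.+1 w / V n 0%N w)) Q
    (fun w => \row_(i < m.+1) (W i.+1 w / W 0%N w)).
Proof.
pose V' n k w := V n k.+1 w / V n 0%N w; pose W' k w := W k.+1 w / W 0%N w.
have mV' n k : measurable_fun setT (V' n k).
  by apply: measurable_funM => //; exact: measurable_inv.
have mW' k : measurable_fun setT (W' k).
  by apply: measurable_funM => //; exact: measurable_inv.
suff : forall f : 'rV[R]_m.+1 -> R, (exists M, forall x, `|f x| <= M) -> continuous f ->
    (fun n => \int[P]_w f (\row_(i < m.+1) V' n i w)) @ \oo -->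
    \int[Q]_w f (\row_(i < m.+1) W' i w).
  move=> H f [M fM] cf; have bf : exists M, forall x, `|f x| <= M by exists M.
  rewrite EFin_Rintegral; last exact: (bounded_mfun_rV cf bf mW').
  apply: cvg_EFin; last exact: H.
  apply: nearW => n; rewrite EFin_Rintegral//; exact: (bounded_mfun_rV cf bf (mV' n)).
move=> f bf cf; have [M fM] := bf.
have M0 : 0 <= M by exact: le_trans (fM 0).
apply/cvgrPdist_le => e e0.
have e3 : 0 < e / 3 by lra.
have M1 : 0 < 2 * M + 1 by lra.
have [delta d0 [Wd Vd]] := expect_bump_small (divr_gt0 e3 M1).
pose c (i : 'I_m.+1) (x : 'rV[R]_m.+2) := x 0 (lift ord0 i) * cutoff_inv delta (x 0 0).
have cc i : continuous (c i).
  have c1 (j : 'I_m.+2) : continuous (fun x : 'rV[R]_m.+2 => x 0 j).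
    exact: coord_continuous.
  have c2 : continuous (fun x : 'rV[R]_m.+2 => cutoff_inv delta (x 0 0)).
    by move=> x; apply: continuous_comp; [exact: c1|exact: continuous_cutoff_inv].
  by move=> x; exact: continuousM (c1 _ x) (c2 x).
have cf' : continuous (fun x => f (\row_i c i x)) by exact: continuous_rV_map.
have bf' : exists M, forall x : 'rV[R]_m.+2, `|f (\row_i c i x)| <= M by exists M.
have lim := fdd_map bf cf cc.
have cmp (v : nat -> R) : `|f (\row_(i < m.+1) (v i.+1 / v 0%N)) -
    f (\row_i c i (\row_(j < m.+2) v j))| <= 0 + 2 * M * bump delta (v 0%N).
  rewrite add0r; have [vd|vd] := ltP `|v 0%N| delta.
    apply: (@le_trans _ _ (2 * M * 1)); last first.
      by apply: ler_wpM2l; [exact: mulr_ge0|exact/bump_ge1/ltW].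
    apply: (le_trans (ler_normB _ _)); have := fM (\row_(i < m.+1) (v i.+1 / v 0%N)).
    by have := fM (\row_i c i (\row_(j < m.+2) v j)); lra.
  have -> : \row_(i < m.+1) (v i.+1 / v 0%N) = \row_i c i (\row_(j < m.+2) v j).
    by apply/rowP => i; rewrite !mxE /c !mxE cutoff_invE.
  by rewrite subrr normr0; apply: mulr_ge0; [exact: mulr_ge0|exact: bump_ge0].
have small x : x <= e / 3 / (2 * M + 1) -> 2 * M * x <= e / 3.
  rewrite ler_pdivlMr// => Hx.
  have [x0|x0] := leP 0 x; first by lra.
  by have : 0 <= M * (- x) by [apply: mulr_ge0; lra]; lra.
have HW := expect_dist_le Q (bounded_mfun_rV cf bf mW') (bounded_mfun_rV cf' bf' mW)
  (bounded_mfun_bump d0 (mW 0%N)) (fun w => cmp (W ^~ w)).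
have /cvgrPdist_le /(_ _ e3) lim3 := lim.
near=> n.
have HV := expect_dist_le P (bounded_mfun_rV cf bf (mV' n)) (bounded_mfun_rV cf' bf' (mV n))
  (bounded_mfun_bump d0 (mV n 0%N)) (fun w => cmp (V n ^~ w)).
have V3 : 2 * M * \int[P]_w bump delta (V n 0%N w) <= e / 3.
  by apply: small; near: n.
have W3 := small _ Wd.
have L3 : `|\int[Q]_w f (\row_i c i (\row_(j < m.+2) W j w)) -
    \int[P]_w f (\row_i c i (\row_(j < m.+2) V n j w))| <= e / 3 by near: n.
move: HV HW L3; rewrite !ler_norml => /andP[? ?] /andP[? ?] /andP[? ?].
by apply/andP; split; lra.
Unshelve. all: by end_near. Qed.

End Vectors.
End RatioLimit.

(** * Uniform tails of the processes *)

Section Processes.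
Context {R : realType}.
Variables (alpha b : R) (A : set (nat -> R)) (rad : nat -> R).
Local Notation cont := (ld_cont alpha b A).
Hypothesis coord_cont : forall k, cont (fun a => a k).
Hypothesis rad_ge : forall a k, A a -> `|a k| <= rad k.
Hypothesis rad_ge0 : forall k, 0 <= rad k.

Lemma ld_cont_eq (f g : (nat -> R) -> R) : (forall a, A a -> f a = g a) -> cont f -> cont g.
Proof.
move=> fg cf a Aa e /(cf a Aa)[r r0 H]; exists r => // c Ac /(H c Ac).
by rewrite !fg.
Qed.

(** Functionals act on functions of all sequences, whereas limits are identified only on [A].
    Continuity at uniform distance 0 shows that [F] sees nothing else. *)
Lemma cont_functional_eq F (f g : (nat -> R) -> R) : cont_functional alpha b A F ->
  cont f -> (forall a, A a -> f a = g a) -> F f = F g.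
Proof.
move=> cF cf fg; have cg := ld_cont_eq fg cf.
apply/eqP; rewrite -subr_eq0 -normr_eq0; apply/negPn/negP => n0.
have pos : 0 < `|F f - F g| by rewrite lt0r n0 normr_ge0.
have [r r0 H] := cF f cf _ pos.
suff : `|F f - F g| < `|F f - F g| by rewrite ltxx.
by apply: H => // a Aa; rewrite fg// subrr normr0 ltW.
Qed.

Context {d1 : measure_display} {T1 : measurableType d1} (P : probability T1 R).
Context {d2 : measure_display} {T2 : measurableType d2} (Q : probability T2 R).

(** [F] along [Z] need not be measurable; off the null set [B] it equals [F] along [lin_form_lim],
    which is, and the integral ignores the change. *)
Lemma proc_weak_cvg_lin_form (V : nat -> nat -> T1 -> R) (W : nat -> T2 -> R)
    (N : nat -> nat) (X : nat -> (nat -> R) -> T1 -> R) (Z : (nat -> R) -> T2 -> R)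
    (B : set T2) :
  (forall n k, measurable_fun setT (V n k)) ->
  (forall k, measurable_fun setT (W k)) ->
  (forall w, cvgn (series (fun k => rad k * `|W k w|))) ->
  (forall m, \forall n \near \oo, (m <= N n)%N) ->
  (forall m, vec_weak_cvg P (fun n w => \row_(i < m.+1) V n i w) Q
     (fun w => \row_(i < m.+1) W i w)) ->
  (forall e : R, 0 < e -> exists m, \forall n \near \oo,
    exists D : T1 -> R, [/\ bounded_mfun D, forall w, 0 <= D w, \int[P]_w D w <= e &
    forall w x, 0 < x <= 1 -> D w < x -> \sum_(m <= k < N n) rad k * `|V n k w| <= x]) ->
  (\forall n \near \oo, forall a w, X n a w = lin_form (fun k => V n k w) (N n) a) ->
  measurable B -> Q B = 0%E ->
  (forall w a, ~ B w -> A a -> Z a w = lin_form_lim W w a) ->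
  proc_weak_cvg alpha b A P X Q Z.
Proof.
move=> mV mW cvgW Noo fdd tails XE mB QB ZE F [M FM] cF.
have bF : bounded_on_cont alpha b A F by exists M.
have clim := lin_form_lim_cont coord_cont rad_ge rad_ge0 cvgW.
rewrite (@integral_eq_off_null _ _ _ Q B _ (fun w => F (lin_form_lim W w))) //; last first.
  move=> w Bw; apply/esym/(cont_functional_eq cF (clim w)) => a Aa.
  by rewrite ZE.
rewrite EFin_Rintegral; last first.
  exact: (bounded_functional_lim coord_cont rad_ge rad_ge0 mW cvgW cF bF).
have bV n := bounded_functional_lin_form coord_cont rad_ge rad_ge0 (mV n) (N n) cF bF.
have EX : \forall n \near \oo, (\int[P]_w (F (fun a => X n a w))%:E)%E =
    (\int[P]_w F (lin_form (fun k => V n k w) (N n)))%:E.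
  apply: filterS XE => n XE; rewrite -EFin_Rintegral//.
  by apply: eq_integral => w _; congr (F _)%:E; apply/funext => a.
apply: cvg_EFin; first by apply: filterS EX => n ->.
have := weak_cvg_functional coord_cont rad_ge rad_ge0 mW cvgW mV Noo fdd tails cF bF.
apply: cvg_trans; apply: near_eq_cvg.
by apply: filterS EX => n /= ->.
Qed.

End Processes.

Lemma vec_weak_cvg_eq_off_null (R : realType) (m : nat)
    (d1 d2 : measure_display) (T1 : measurableType d1) (T2 : measurableType d2)
    (P : probability T1 R) (V : nat -> T1 -> 'rV[R]_m.+1)
    (Q : probability T2 R) (W W' : T2 -> 'rV[R]_m.+1) (B : set T2) :
  measurable B -> Q B = 0%E -> (forall w, ~ B w -> W w = W' w) ->
  vec_weak_cvg P V Q W -> vec_weak_cvg P V Q W'.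
Proof.
move=> mB QB WW' H f bf cf; have := H f bf cf.
by rewrite (integral_eq_off_null mB QB (V := fun w => f (W' w)))// => w /WW' ->.
Qed.

Lemma ler_sum_iota (R : realType) (f : nat -> R) (m n k : nat) : (forall i, 0 <= f i) ->
  (m <= k < n)%N -> f k <= \sum_(m <= i < n) f i.
Proof.
move=> f0 kmn; rewrite (bigD1_seq k) ?iota_uniq ?mem_index_iota//=.
by rewrite lerDl sumr_ge0.
Qed.

(** * Remainders of the sample covariances *)

Section NoiseTails.
Context {R : realType} {d : measure_display} {T : measurableType d}.
Variables (P : probability T R) (eps : nat -> T -> R) (alpha : R).
Hypothesis alpha01 : 0 < alpha < 1.
Hypothesis meps : forall t, measurable_fun setT (eps t).
Hypothesis indep_eps : mutual_indep P eps.
Hypothesis cf_eps : forall t, has_cf P (eps t) (fun u => expR (- `|u| `^ alpha)) (fun=> 0).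

Variables (rad u : nat -> R) (k0 : nat).
Hypothesis rad_ge0 : forall k, 0 <= rad k.
Hypothesis u_ge0 : forall k, 0 <= u k.
Hypothesis cvg_u : cvgn (series u).
Hypothesis rad_le : forall k, (k0 <= k)%N ->
  rad k <= 1 /\ rad k `^ alpha * (1 - ln (rad k)) <= u k.

Local Notation scale n := ((n%:R * ln n%:R) `^ alpha^-1).

Lemma measurable_ngamma n k : measurable_fun setT (ngamma eps n k).
Proof. by apply: measurable_sum => t; exact: measurable_funM. Qed.

(** [D] sums the truncated products over all lags beyond [m] and all times. Each truncated product
    costs [K u_k / n] and a lag has at most [n] of them, so the mean is at most [K] times a tail of
    [series u]. If [D < 1], no truncation is active and [D] bounds the remainder itself. *)
Lemma noise_tails (e : R) : 0 < e -> exists m, \forall n \near \oo,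
  exists D : T -> R, [/\ bounded_mfun D, forall w, 0 <= D w, \int[P]_w D w <= e &
    forall w x, 0 < x <= 1 -> D w < x ->
      \sum_(m <= k < n.-1) rad k * `|ngamma eps n k.+1 w / scale n| <= x].
Proof.
move=> e0; have [a0 a1] := andP alpha01.
pose K := moment_const alpha * 25 * (1 + 2 / alpha).
have K0 : 0 <= K.
  have [_ mc0] := moment_const_ge0 alpha01.
  apply: mulr_ge0; first exact: mulr_ge0.
  by rewrite addr_ge0// divr_ge0// ltW.
have eK : 0 < e / (K + 1) by rewrite divr_gt0// ltr_wpDl.
have ndu : nondecreasing_seq (series u) by exact: nondecreasing_series.
have /cvgrPdist_le /(_ _ eK) [m1 _ Hm1] := cvg_u.
pose m := (k0 + m1)%N; exists m.
have m1m : (m1 <= m)%N by rewrite /m leq_addl.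
have utail n : \sum_(m <= k < n) u k <= e / (K + 1).
  have [nm|mn] := leqP n m; first by rewrite big_geq// ltW.
  have -> : \sum_(m <= k < n) u k = series u n - series u m by rewrite sub_series_geq// ltnW.
  have := Hm1 m m1m; rewrite ler_norml => /andP[_].
  have := nondecreasing_cvgn_le ndu cvg_u n.
  lra.
near=> n.
have ln1 : 1 <= ln n%:R :> R.
  have : expR 1 <= n%:R :> R by near: n; exact: nbhs_infty_ger.
  move=> en; rewrite -[leLHS](@expRK R) ler_ln ?posrE ?expR_gt0//.
  exact: lt_le_trans (expR_gt0 _) en.
have n0 : 0 < n%:R :> R.
  by rewrite lt_neqAle ler0n andbT; apply: contraTneq ln1 => <-; rewrite ln0// -ltNge.
have c0 : 0 < scale n by apply: powR_gt0; apply: mulr_gt0 => //; lra.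
pose z k t w := rad k / scale n * `|eps t w * eps (t + k.+1)%N w|.
have z0 k t w : 0 <= z k t w by rewrite mulr_ge0// divr_ge0// ltW.
have bz k t : bounded_mfun (fun w => Num.min 1 (z k t w)).
  by apply: bounded_mfun_min1 => //; rewrite divr_ge0// ltW.
have fz0 k t w : 0 <= Num.min 1 (z k t w) by rewrite le_min ler01 z0.
have ez k t : (m <= k)%N -> \int[P]_w Num.min 1 (z k t w) <= K * u k / n%:R.
  move=> mk; have k0k : (k0 <= k)%N by apply: leq_trans mk; rewrite leq_addr.
  have [r1 ru] := rad_le k0k; rewrite ler_pdivlMr// mulrC.
  (* The moment estimate needs a positive weight; for weight 0 the truncated product vanishes. *)
  have [r0|r0] := eqVneq (rad k) 0.
    under eq_Rintegral do rewrite /z r0 !mul0r minElt ltr10.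
    by rewrite expect_cst mulr0; exact: mulr_ge0.
  have rpos : 0 < rad k <= 1 by rewrite lt0r r0 rad_ge0.
  have tt : t != (t + k.+1)%N by rewrite -[X in X != _]addn0 eqn_add2l.
  apply: le_trans (stable_noise_moment alpha01 meps indep_eps cf_eps tt rpos ln1) _.
  by rewrite -/K ler_wpM2l.
pose D w := \sum_(m <= k < n.-1) \sum_(1 <= t < (n - k.+1).+1) Num.min 1 (z k t w).
have Dk0 k w : 0 <= \sum_(1 <= t < (n - k.+1).+1) Num.min 1 (z k t w) by apply: sumr_ge0.
exists D; split.
- by do 2!(apply: bounded_mfun_sum => ? _).
- by move=> w; apply: sumr_ge0.
- rewrite /D expect_sum; last by move=> k _; apply: bounded_mfun_sum.
  apply: (@le_trans _ _ (\sum_(m <= k < n.-1) K * u k)); last first.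
    rewrite -mulr_sumr; apply: (@le_trans _ _ (K * (e / (K + 1)))).
      by apply: ler_wpM2l => //; exact: utail.
    rewrite mulrA ler_pdivrMr; last by lra.
    by rewrite mulrC ler_pM2l//; lra.
  rewrite big_nat_cond [leRHS]big_nat_cond; apply: ler_sum => k /andP[/andP[mk _] _].
  rewrite expect_sum//.
  apply: (@le_trans _ _ (\sum_(1 <= t < (n - k.+1).+1) K * u k / n%:R)).
    by apply: ler_sum => t _; exact: ez.
  rewrite sumr_const_nat subn1 /= -[leRHS](divfK (lt0r_neq0 n0)) -[leLHS]mulr_natr.
  apply: ler_wpM2l; first by apply: divr_ge0; [exact: mulr_ge0|exact: ltW].
  by rewrite ler_nat leq_subr.
move=> w x /andP[x0 x1] Dx; apply: le_trans (ltW Dx).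
rewrite /D big_nat_cond [leRHS]big_nat_cond; apply: ler_sum => k /andP[kmn _].
(* Every inner sum is one nonnegative piece of [D < x <= 1], so each of its terms is below 1 and
   coincides with [z]. *)
have Dk1 : \sum_(1 <= t < (n - k.+1).+1) Num.min 1 (z k t w) < 1.
  apply: lt_le_trans x1; apply: le_lt_trans Dx.
  exact: (ler_sum_iota (fun k => Dk0 k w) kmn).
apply: (@le_trans _ _ (\sum_(1 <= t < (n - k.+1).+1) z k t w)).
  rewrite /ngamma normrM normfV (gtr0_norm c0) mulrCA mulrC -mulr_sumr.
  by apply: ler_wpM2l; [rewrite divr_ge0// ltW|exact: ler_norm_sum].
rewrite big_nat_cond [leRHS]big_nat_cond; apply: ler_sum => t /andP[tn _].
have := ler_sum_iota (fun t => fz0 k t w) tn => /= /le_lt_trans/(_ Dk1).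
by rewrite gt_min ltxx /= => /ltW z1; rewrite le_min z1 lexx.
Unshelve. all: by end_near. Qed.

End NoiseTails.

(** The new bound is the bump of the denominator plus [D / r]. If it is below [x <= 1], the bump is
    below 1, so the denominator exceeds [delta >= r]; also [D < r x], so the numerator sum is at
    most [r x] and the quotient at most [x]. Capping [r] at 1 keeps [r x] in the admissible
    range. *)
Lemma ratio_tails (R : realType) (d : measure_display) (T : measurableType d)
    (P : probability T R) (U : nat -> nat -> T -> R) (rad : nat -> R) (N : nat -> nat) :
  (forall n k, measurable_fun setT (U n k)) ->
  (forall k, 0 <= rad k) ->
  (forall e : R, 0 < e -> exists2 delta : R, 0 < delta &
    \forall n \near \oo, \int[P]_w bump delta (U n 0%N w) <= e) ->
  (forall e : R, 0 < e -> exists m, \forall n \near \oo,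
    exists D : T -> R, [/\ bounded_mfun D, forall w, 0 <= D w, \int[P]_w D w <= e &
      forall w x, 0 < x <= 1 -> D w < x ->
        \sum_(m <= k < N n) rad k * `|U n k.+1 w| <= x]) ->
  forall e : R, 0 < e -> exists m, \forall n \near \oo,
    exists D : T -> R, [/\ bounded_mfun D, forall w, 0 <= D w, \int[P]_w D w <= e &
      forall w x, 0 < x <= 1 -> D w < x ->
        \sum_(m <= k < N n) rad k * `|U n k.+1 w / U n 0%N w| <= x].
Proof.
move=> mU rad0 small tails e e0; have e2 : 0 < e / 2 by lra.
have [delta d0 Hd] := small _ e2.
pose r := Num.min delta 1; have r0 : 0 < r by rewrite lt_min d0 ltr01.
have r1 : r <= 1 by rewrite ge_min lexx orbT.
have rd : r <= delta by rewrite ge_min lexx.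
have [m Hm] := tails _ (mulr_gt0 r0 e2); exists m.
apply: filterS2 Hd Hm => n bump_n [D [bD D0 ED Dx]].
have bb := bounded_mfun_bump d0 (mU n 0%N).
have bD' : bounded_mfun (fun w => r^-1 * D w) by exact: bounded_mfunZ.
exists (fun w => bump delta (U n 0%N w) + r^-1 * D w); split.
- exact: bounded_mfunD.
- by move=> w; rewrite addr_ge0 ?bump_ge0// mulr_ge0// invr_ge0 ltW.
- rewrite (expectD _ bb bD') (expectZ _ _ bD).
  rewrite [leRHS]splitr; apply: lerD => //.
  by rewrite mulrC ler_pdivrMr// mulrC.
move=> w x /andP[x0 x1] H.
have b0 := bump_ge0 (U n 0%N w) d0.
have rD0 : 0 <= r^-1 * D w by rewrite mulr_ge0// invr_ge0 ltW.
have dU : delta < `|U n 0%N w|.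
  rewrite ltNge; apply/negP => /(bump_ge1 d0).
  by move: (r^-1 * D w) H rD0 => q H rD0; lra.
have DD : D w < r * x.
  have : r^-1 * D w < x by apply: le_lt_trans H; rewrite lerDr.
  by rewrite mulrC ltr_pdivrMr// mulrC.
have rx : 0 < r * x <= 1 by rewrite mulr_gt0//= -[leRHS]mulr1 ler_pM// ltW.
have := Dx w _ rx DD => S.
have U0 : 0 < `|U n 0%N w| by exact: lt_trans dU.
have -> : \sum_(m <= k < N n) rad k * `|U n k.+1 w / U n 0%N w| =
    (\sum_(m <= k < N n) rad k * `|U n k.+1 w|) / `|U n 0%N w|.
  by rewrite mulr_suml; apply: eq_bigr => k _; rewrite normrM normfV mulrA.
rewrite ler_pdivrMr//; apply: (le_trans S); rewrite mulrC ler_pM2l//.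
exact: le_trans rd (ltW dU).
Qed.

Lemma Xn_lin_form (R : realType) (T : Type) (eps : nat -> T -> R) (alpha : R) n a w :
  Xn eps alpha n a w =
  lin_form (fun k => ngamma eps n k.+1 w / (n%:R * ln n%:R) `^ alpha^-1) n.-1 a.
Proof.
rewrite /Xn /lin_form /series /= big_add1 mulr_sumr; apply: eq_bigr => k _.
by rewrite powRN /Defs.coord /= mulrC mulrA.
Qed.

(** Rests on [(n / ln n)^(1/alpha) = n^(2/alpha) / (n ln n)^(1/alpha)]: the norming of the ratio is
    the quotient of the normings of lag 0 and of the other lags. For [1 < n] the logarithm is
    positive. *)
Lemma Xtn_lin_form (R : realType) (T : Type) (eps : nat -> T -> R) (alpha : R) n a w :
  0 < alpha -> (1 < n)%N ->
  Xtn eps alpha n a w =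
  lin_form (fun k => ngamma eps n k.+1 w / (n%:R * ln n%:R) `^ alpha^-1 /
    (ngamma eps n 0 w / n%:R `^ (2 / alpha))) n.-1 a.
Proof.
move=> a0 n1; have nR : 1 < n%:R :> R by rewrite ltr1n.
have n0 : 0 < n%:R :> R by apply: lt_trans nR.
have l0 : 0 < ln n%:R :> R by exact: ln_gt0.
rewrite /Xtn /lin_form /series /= big_add1 mulr_sumr; apply: eq_bigr => k _.
have -> : (n%:R / ln n%:R) `^ alpha^-1 =
    n%:R `^ (2 / alpha) / (n%:R * ln n%:R) `^ alpha^-1 :> R.
  have -> : n%:R / ln n%:R = n%:R `^ 2 * (n%:R * ln n%:R)^-1 :> R.
    by rewrite (powR_mulrn 2 (ltW n0)); field; rewrite !gt_eqF.
  rewrite powRM ?powR_ge0 ?invr_ge0 ?mulr_ge0 ?(ltW n0) ?(ltW l0)// -powRrM.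
  congr (_ * _); rewrite -[X in X `^ _](@powR_inv1 R) ?mulr_ge0 ?(ltW n0) ?(ltW l0)//.
  by rewrite -powRrM mulN1r powRN.
rewrite /Defs.coord /= invfM invrK.
move: (n%:R `^ _) ((n%:R * _) `^ _)^-1 (ngamma eps n 0 w)^-1 => p c g; ring.
Qed.

Unset Implicit Arguments.

Theorem theorem3p3 (R : realType)
  (d1 : measure_display) (T1 : measurableType d1) (P : probability T1 R)
  (d2 : measure_display) (T2 : measurableType d2) (Q : probability T2 R)
  (alpha : R) (eps : nat -> T1 -> R) (Y : nat -> T2 -> R)
  (sigma1 sigma2 b : R) (A : set (nat -> R)) :
  0 < alpha < 1 ->
  (* (eps_t) i.i.d. symmetric alpha-stable, E e^{iu eps} = e^{-|u|^alpha} *)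
  (forall t, measurable_fun setT (eps t)) ->
  mutual_indep P eps ->
  (forall t, has_cf P (eps t) (fun u => expR (- `|u| `^ alpha)) (fun=> 0)) ->
  (* Y_0 ~ S_{alpha/2}(sigma1,1,0), Y_k ~ S_alpha(sigma2,0,0), independent *)
  0 < sigma1 -> 0 < sigma2 ->
  (forall k, measurable_fun setT (Y k)) ->
  mutual_indep Q Y ->
  has_cf Q (Y 0) (stable_cf_re (alpha / 2) sigma1 1) (stable_cf_im (alpha / 2) sigma1 1) ->
  (forall k, has_cf Q (Y k.+1) (stable_cf_re alpha sigma2 0) (stable_cf_im alpha sigma2 0)) ->
  (* sigma1, sigma2 are the constants of the finite-dimensional limit theorem *)
  (forall m : nat, vec_weak_cvg P
     (fun n w => \row_(i < m.+1)
        (if (i : nat) == 0%N then ngamma eps n 0 w / n%:R `^ (2 / alpha)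
         else ngamma eps n i w / (n%:R * ln n%:R) `^ alpha^-1))
     Q (fun w => \row_(i < m.+1) Y i w)) ->
  (* b large enough that h is concave on (0, oo) *)
  0 < b ->
  (forall x y t : R, 0 < x -> 0 < y -> 0 <= t <= 1 ->
     t * hfun alpha b x + (1 - t) * hfun alpha b y <=
     hfun alpha b (t * x + (1 - t) * y)) ->
  (* A compact in (l^alpha log l, d), with sum_k sup_{a in A} h(a_k) < oo *)
  ld_compact alpha b A ->
  (\sum_(0 <= k <oo) ereal_sup [set (hfun alpha b (a k))%:E | a in A] < +oo)%E ->
  (* conclusions *)
  {ae Q, forall w, (forall a, A a -> cvgn (Yseries Y a w)) /\
                   ld_cont alpha b A (fun a => Yproc Y a w)} /\
  {ae Q, forall w, (forall a, A a -> cvgn (Yseries Y a w)) /\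
                   ld_cont alpha b A (fun a => Ytproc Y a w)} /\
  proc_weak_cvg alpha b A P (Xn eps alpha) Q (Yproc Y) /\
  proc_weak_cvg alpha b A P (Xtn eps alpha) Q (Ytproc Y).
Proof.
move=> a01 meps ieps cfe s1 s2 mY iY cfY0 cfY fdd b0 hc [Asub _] sumA.
have [a0 a1] := andP a01.
have coord_cont k := coord_ld_cont a01 b0 hc k Asub.
have [rad [u [k0 [rad_ge rad0 u0 cu ru]]]] := summable_weights a01 b0 hc sumA.
have mradY k : measurable_fun setT (fun w => rad k * `|Y k.+1 w|).
  by apply: measurable_funM => //; exact: measurableT_comp.
have [N [mN QN cvgN]] : exists N, [/\ measurable N, Q N = 0%E &
    forall w, ~ N w -> cvgn (series (fun k => rad k * `|Y k.+1 w|))].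
  pose K := moment_const alpha * (5 * sigma2 `^ alpha + 1).
  have K0 : 0 <= K.
    have [_ mc0] := moment_const_ge0 a01.
    by apply: mulr_ge0 => //; rewrite addr_ge0// mulr_ge0// powR_ge0.
  apply: (@ae_summable _ _ _ Q (fun k w => rad k * `|Y k.+1 w|) (fun k => K * u k) k0) => //.
  - by move=> k w; rewrite mulr_ge0.
  - by move=> k; exact: mulr_ge0.
  - exact: is_cvg_seriesZ.
  move=> k /ru[r1 ruk]; have [r0|r0] := eqVneq (rad k) 0.
    under eq_Rintegral do rewrite r0 mul0r minElt ltr10.
    by rewrite expect_cst; exact: mulr_ge0.
  have rpos : 0 < rad k <= 1 by rewrite lt0r r0 rad0.
  have cfk v : expR (- (sigma2 `^ alpha * `|v| `^ alpha)) <= \int[Q]_w cos (v * Y k.+1 w).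
    by rewrite (has_cf_re v (cfY k)) /stable_cf_re mulr0 !mul0r cos0 mulr1.
  apply: (le_trans (stable_min1_moment a01 (powR_ge0 _ _) (mY k.+1) cfk rpos)).
  by rewrite -/K ler_wpM2l.
(* The skewness of [Y 0] enters the real part only through a cosine, bounded by 1, which leaves the
   exponential decay. *)
have Y0_neq0 : Q [set w | Y 0%N w = 0] = 0%E.
  have sa : 0 < sigma1 `^ (alpha / 2) by exact: powR_gt0.
  apply: (cf_no_atom (mY 0%N) (divr_gt0 a0 (ltr0n _ 2)) sa) => v.
  rewrite (has_cf_re v cfY0) /stable_cf_re -[leRHS]mulr1.
  by apply: ler_wpM2l; [exact: expR_ge0|exact: cos_le1].
(* Killing [Y] on [N] makes the dominating series converge at every sample point, as the limit
   lemmas demand, and leaves the finite-dimensional limits unchanged. *)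
pose Y' k w := Y k w * \1_(~` N) w.
have mNC : measurable (~` N) by exact: measurableC.
have mY' k : measurable_fun setT (Y' k) by exact/measurable_funM/measurable_indic.
have Y'E k w : ~ N w -> Y' k w = Y k w.
  by move=> Nw; rewrite /Y' indicE mem_set ?mulr1.
have Y'N k w : N w -> Y' k w = 0.
  by move=> Nw; rewrite /Y' indicE memNset ?mulr0//= => /(_ Nw).
have cvgY' w : cvgn (series (fun k => rad k * `|Y' k.+1 w|)).
  have [Nw|Nw] := pselect (N w); last first.
    by under eq_fun do rewrite (Y'E _ _ Nw); exact: cvgN.
  under eq_fun do rewrite (Y'N _ _ Nw) normr0 mulr0.
  apply/cvg_ex; exists 0; rewrite (_ : series _ = cst 0); first exact: cvg_cst.
  by apply/funext => n; rewrite /series /= big1.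
have Y'0_neq0 : Q [set w | Y' 0%N w = 0] = 0%E.
  have mA Z : measurable_fun setT Z -> measurable [set w : T2 | Z w = 0 :> R].
    by move=> mZ; rewrite -[X in measurable X]setTI; exact: mZ (measurable_set1 0).
  have mU : measurable (N `|` [set w | Y 0%N w = 0]) by apply: measurableU => //; exact: mA.
  apply: (subset_measure0 (mA _ (mY' 0%N)) mU).
    move=> w /=; have [Nw|Nw] := pselect (N w); first by left.
    by rewrite Y'E//; right.
  apply/eqP; rewrite eq_le measure_ge0 andbT.
  apply: (le_trans (measureU2 _ mN (mA _ (mY 0%N)))).
  have : (Q N + Q [set w | Y 0%N w = 0%R] <= 0)%E by rewrite QN Y0_neq0 adde0.
  exact.
(* One array holds denominator (index 0) and numerators, so the ratio process is obtained from the
   joint convergence; [X_n] uses the shifted array. *)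
pose U n k w := if k == 0%N then ngamma eps n 0 w / n%:R `^ (2 / alpha)
  else ngamma eps n k w / (n%:R * ln n%:R) `^ alpha^-1.
have mU n k : measurable_fun setT (U n k).
  by case: k => [|k]; rewrite /U /=; apply: measurable_funM => //; exact: measurable_ngamma.
have fddU m : vec_weak_cvg P (fun n w => \row_(i < m.+1) U n i w) Q
    (fun w => \row_(i < m.+1) Y' i w).
  apply: (vec_weak_cvg_eq_off_null mN QN _ (fdd m)) => w Nw.
  by apply/rowP => i; rewrite !mxE Y'E.
have predn_infty m : \forall n \near \oo, (m <= n.-1)%N.
  by exists m.+1 => // n /=; case: n.
have tailsU := @noise_tails _ _ _ P eps alpha a01 meps ieps cfe rad u k0 rad0 u0 cu ru.
have mW k : measurable_fun setT (Y' k.+1) := mY' k.+1.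
have WE w : ~ N w -> forall a, lin_form_lim (fun k => Y' k.+1) w a = Yproc Y a w.
  move=> Nw a; rewrite /lin_form_lim /Yproc /Yseries; congr (limn _); apply/funext => n.
  by rewrite /lin_form /series /=; apply: eq_bigr => k _; rewrite Y'E.
have cvgYs w a : ~ N w -> A a -> cvgn (Yseries Y a w).
  move=> Nw Aa; have cw := lin_form_cvg rad_ge rad0 cvgY' (w := w) Aa.
  rewrite (_ : Yseries Y a w = lin_form (fun k => Y' k.+1 w) ^~ a)//.
  apply/funext => n; rewrite /lin_form /Yseries /series /=.
  by apply: eq_bigr => k _; rewrite Y'E.
have contY w : ~ N w -> ld_cont alpha b A (fun a => Yproc Y a w).
  move=> Nw; rewrite (_ : (fun a => _) = lin_form_lim (fun k => Y' k.+1) w).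
    exact: (lin_form_lim_cont coord_cont rad_ge rad0 cvgY').
  by apply/funext => a; rewrite WE.
split; [|split; [|split]].
- exists N; split => // w /= H; apply: contrapT => Nw; apply: H.
  by split => [a|]; [exact: cvgYs|exact: contY].
(* At a fixed sample point, division by [Y 0 w] is multiplication by a constant. *)
- exists N; split => // w /= H; apply: contrapT => Nw; apply: H.
  by split => [a|]; [exact: cvgYs|exact/ld_contM_cst/contY].
- apply: (@proc_weak_cvg_lin_form _ alpha b A rad coord_cont rad_ge rad0 _ _ P _ _ Q
    (fun n k => U n k.+1) (fun k => Y' k.+1) predn _ _ N) => //.
  + exact: fdd_shift.
  + by apply: nearW => n a w; rewrite Xn_lin_form.
  + by move=> w a Nw _; rewrite WE.
- have small e : 0 < e -> exists2 delta : R, 0 < delta &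
      \forall n \near \oo, \int[P]_w bump delta (U n 0%N w) <= e.
    move=> e0; have [delta d0 [_ H]] := expect_bump_small mU mY' fddU Y'0_neq0 e0.
    by exists delta.
  have tailsR := ratio_tails mU rad0 small tailsU.
  have mW' k : measurable_fun setT (fun w => Y' k.+1 w / Y' 0%N w).
    by apply: measurable_funM => //; exact: measurable_inv.
  have WE' w a : A a -> lin_form_lim (fun k w => Y' k.+1 w / Y' 0%N w) w a =
      lin_form_lim (fun k => Y' k.+1) w a / Y' 0%N w.
    move=> Aa; have := lin_form_cvg rad_ge rad0 cvgY' (w := w) Aa => cw.
    apply/cvg_lim => //.
    rewrite (_ : (fun n => _) = fun n =>
      lin_form (fun k => Y' k.+1 w) n a * (Y' 0%N w)^-1); first exact: cvgMl.
    apply/funext => n; rewrite /lin_form /series /= mulr_suml.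
    by apply: eq_bigr => k _; rewrite mulrA.
  apply: (@proc_weak_cvg_lin_form _ alpha b A rad coord_cont rad_ge rad0 _ _ P _ _ Q
    (fun n k w => U n k.+1 w / U n 0%N w) (fun k w => Y' k.+1 w / Y' 0%N w) predn _ _ N) => //.
  + by move=> n k; apply: measurable_funM => //; exact: measurable_inv.
  + move=> w; under eq_fun do rewrite normrM mulrA mulrC.
    exact: is_cvg_seriesZ.
  + exact: fdd_ratio.
  + by exists 2%N => // n /= n2 a w; rewrite Xtn_lin_form.
  + by move=> w a Nw Aa; rewrite WE'// WE// Y'E.
Qed.
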